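(* Let $1\le k_1<k_2<\cdots$ be an increasing sequence of integers. Let $f(x)=\sum_{j=1}^\infty a_j\sin 2\pi jx$ and assume that $|a_j|=\mathcal O(j^{-s})$ for some $s>1/2$. Let $\{c_n,n\ge1\}$ be a sequence of reals such that $$\sum_n c_n^2\,\sigma_{1-2s}(k_n)(\log n)^2<\infty .$$ Then the series $\sum_n c_nf_{k_n}$ converges almost everywhere.
   Context: $f_k(x)=f(kx)$. For real $\alpha$ and a positive integer $k$, $\sigma_\alpha(k)=\sum_{d\mid k}d^\alpha$. The series defining $f$ is understood in $L^2([0,1])$. *)

(* Defs.v *)
From HB Require Import structures.
From mathcomp Require Export all_boot all_order all_algebra.
From mathcomp Require Export all_classical all_reals all_analysis.

Set Implicit Arguments.
Unset Strict Implicit.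
Unset Printing Implicit Defensive.

Import Order.TTheory GRing.Theory Num.Theory.
Import numFieldNormedType.Exports.

Local Open Scope classical_set_scope.
Local Open Scope ring_scope.

(* Sequences are indexed by n >= 1 as in the mathematics; the value at index 0
   of a sequence nat -> R is never used. *)

(* Meaningful for 0 < k only, since [divisors 0 = [:: 1]]. *)
Definition sigma (R : realType) (alpha : R) (k : nat) : R :=
  \sum_(d <- divisors k) d%:R `^ alpha.

Definition dilate (R : realType) (f : R -> R) (k : nat) : R -> R :=
  fun x => f (k%:R * x).

Definition sine_psum (R : realType) (a : nat -> R) (N : nat) (x : R) : R :=
  \sum_(1 <= j < N.+1) a j * sin (2 * pi * j%:R * x).

(* f is any measurable 1-periodic representative of the L^2([0,1]) sum of the
   sine series: the periodic extension gives a meaning to f(kx). *)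
Definition is_sine_series (R : realType) (a : nat -> R) (f : R -> R) : Prop :=
  [/\ measurable_fun [set: R] f,
      forall x, f (x + 1) = f x
    & (\int[lebesgue_measure]_(x in `[0%R, 1%R])
         ((f x - sine_psum a N x) ^+ 2)%:E)%E @[N --> \oo] --> 0%E].

(* Main.v *)
Require Import Defs.
From HB Require Import structures.
From mathcomp Require Import all_boot all_order all_algebra.
From mathcomp Require Import all_classical all_reals all_analysis.
From mathcomp Require Import measurable_realfun.
From mathcomp Require Import ring lra zify.

(** Put [w d = d^(1-2s)]. Then [a j ^ 2 = O (w j / j)], the sum of [w j / j]
    converges, and the arithmetic factor of the hypothesis is the sum of [w]
    over the divisors of [k n]; write [D] for this divisor sum.

    Truncation. In the term of index [n] only the frequencies of [f] below a
    cut polynomial in [n] are kept. What is discarded has square norm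
    [O (n^-2)], so the discarded series converges absolutely almost everywhere
    ([ae_cvgn_dilated_series]). For the series of sine polynomials that remains
    a maximal inequality of weak type is proved on every interval [[-m, m]]
    ([dilated_maximal_inequality]), where the term of index [n] is charged
    [c n ^ 2 * D (k n) * (1 + log n)^2]. Applied to tails of the series it
    gives convergence ([ae_cvgn_of_maximal_bound]).

    Square norms. By orthogonality they are sums over the frequencies [v] of
    squares of the coefficients [beta v], the sum of [c n * a (v / k n)] over
    the [n] such that [k n] divides [v]. Cauchy-Schwarz, with [a j] split as
    [j^(-1/2) * (w j)^(1/2)], bounds [beta v ^ 2] by the product of the sum of
    [c n ^ 2 / (v / k n)] and the sum of [w (v / k n)]. The latter is at most
    [D v], hence at most [D (k n) * D j] when [v = k n * j]. Summed over the
    frequencies below the cut, [D j / j] costs a factor [O (log n)]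
    ([dilated_coef_sqr_le_log]). The Rademacher-Menshov inequality costs
    [log^2], and on top of that it would exceed the hypothesis. But if all the
    [k n] involved lie in one dyadic block [[K, 2 K)], only quotients comparable
    with [j] occur in the second factor, and the logarithm disappears
    ([dilated_coef_sqr_le_block]).

    Partial sums. They are therefore split at the powers of 2 that the
    increasing sequence [k] crosses. Inside a block the Rademacher-Menshov
    inequality is paid for by [log^2], with no further loss
    ([sym_int_block_maximal_le]). The sum of all terms with [k n < 2^q] is
    compared with the average of the whole sum over a window of half-length
    [2^-q]. These averages are controlled, for all [q] at once, by the
    Hardy-Littlewood maximal inequality ([window_average_exceptional_set]).
    The difference has the multipliers
    [(k n < 2^q) - sinc (2 pi k n j / 2^q)], whose squares sum over [q] to
    [O (1 + log j)] ([sum_window_multiplier_le]); with the [O (log n)] of the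
    square norms this is again [log^2] ([sum_sym_int_defect_sqr_le]). *)

Set Implicit Arguments.
Unset Strict Implicit.
Unset Printing Implicit Defensive.

Import Order.TTheory GRing.Theory Num.Theory.
Import numFieldNormedType.Exports.

Local Open Scope classical_set_scope.
Local Open Scope ring_scope.

(** * Finite sums and divisors *)

Lemma ler_sum_image (R : realType) (I J : eqType) (s : seq I) (t : seq J)
    (P : pred I) (g : I -> J) (phi : J -> R) :
  (forall y, 0 <= phi y) -> uniq s -> uniq t ->
  {in [seq x <- s | P x] &, injective g} ->
  (forall x, x \in s -> P x -> g x \in t) ->
  \sum_(x <- s | P x) phi (g x) <= \sum_(y <- t) phi y.
Proof.
move=> phi0 us ut ginj gst.
pose u := [seq g x | x <- s & P x].
have uu : uniq u by rewrite map_inj_in_uniq ?filter_uniq.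
have -> : \sum_(x <- s | P x) phi (g x) = \sum_(y <- u) phi y.
  by rewrite /u big_map big_filter.
rewrite [leRHS](bigID (fun y => y \in u)) /= -[leLHS]addr0 lerD //; last first.
  by apply: sumr_ge0.
rewrite -[leRHS]big_filter le_eqVlt; apply/orP; left; apply/eqP.
apply: perm_big; apply: uniq_perm => //; first exact: filter_uniq.
move=> y; rewrite mem_filter; apply/idP/idP => [yu|/andP[]//].
rewrite yu; case/mapP: yu => x; rewrite mem_filter => /andP[Px xs] ->.
exact: gst.
Qed.

(** A divisor [d] of [k * j] is [d / gcd (d, j)], a divisor of [k], times
    [gcd (d, j)], a divisor of [j]. *)
Lemma sum_divisors_mul_le (R : realType) (k j : nat) (phi : nat -> R) :
  (forall d, 0 <= phi d) -> (0 < k)%N -> (0 < j)%N ->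
  \sum_(d <- divisors (k * j)) phi d <=
  \sum_(d <- divisors k) \sum_(e <- divisors j) phi (d * e)%N.
Proof.
move=> phi0 k0 j0.
rewrite -(big_allpairs (F := fun p : nat * nat => phi (p.1 * p.2)%N)) /=.
have kj0 : (0 < k * j)%N by rewrite muln_gt0 k0.
have -> : \sum_(d <- divisors (k * j)) phi d =
    \sum_(d <- divisors (k * j))
       (fun p : nat * nat => phi (p.1 * p.2)%N) (d %/ gcdn d j, gcdn d j)%N.
  by apply: eq_bigr => d _ /=; rewrite divnK ?dvdn_gcdl.
apply: (ler_sum_image (phi := fun p : nat * nat => phi (p.1 * p.2)%N)
          (g := fun d => (d %/ gcdn d j, gcdn d j)%N)) => //.
- exact: divisors_uniq.
- by apply: allpairs_uniq; rewrite ?divisors_uniq // => -[? ?] [? ?].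
- move=> x y _ _ [] + e2; rewrite e2 => e1.
  by rewrite -(divnK (dvdn_gcdl x j)) e2 e1 -e2 divnK // e2 dvdn_gcdl.
- move=> d; rewrite -dvdn_divisors // => dkj _.
  have g0 : (0 < gcdn d j)%N by rewrite gcdn_gt0 j0 orbT.
  apply: allpairs_f; rewrite -dvdn_divisors ?dvdn_gcdr //.
  have cop : coprime (d %/ gcdn d j) (j %/ gcdn d j).
    rewrite /coprime -(eqn_pmul2r g0) mul1n muln_gcdl.
    by rewrite !divnK ?dvdn_gcdl ?dvdn_gcdr.
  rewrite -(Gauss_dvdl _ cop) -(dvdn_pmul2r g0) -mulnA.
  by rewrite !divnK ?dvdn_gcdl ?dvdn_gcdr.
Qed.

Lemma sum_multiplesE (R : realType) (e V : nat) (G : nat -> R) : (0 < e)%N ->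
  \sum_(1 <= v < V.+1 | (e %| v)%N) G (v %/ e)%N =
  \sum_(1 <= j < (V %/ e).+1) G j.
Proof.
move=> e0; elim: V => [|V IH]; first by rewrite div0n !big_geq.
rewrite big_mkcond big_nat_recr //= -big_mkcond IH divnS //.
by case: (e %| V.+1)%N; rewrite /= ?add0n ?addr0 // add1n [RHS]big_nat_recr.
Qed.

Lemma sum_multiples_le (R : realType) (e V J : nat) (G : nat -> R) :
  (0 < e)%N -> (forall j, (0 < j)%N -> 0 <= G j) ->
  (forall j, (J <= j)%N -> G j = 0) ->
  \sum_(1 <= v < V | (e %| v)%N) G (v %/ e)%N <= \sum_(1 <= j < J) G j.
Proof.
move=> e0 G0 GJ.
have G0' p q : (0 < p)%N -> 0 <= \sum_(p <= j < q) G j.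
  move=> p0; rewrite big_nat_cond; apply: sumr_ge0 => j.
  by move=> /andP[/andP[pj _] _]; apply: G0; exact: leq_trans pj.
case: V => [|V]; first by rewrite big_geq // G0'.
rewrite sum_multiplesE //; have [VJ|JV] := leqP (V %/ e).+1 J.
  by rewrite [leRHS](@big_cat_nat _ _ _ (V %/ e).+1) //= lerDl G0'.
case: J GJ JV => [|J] GJ JV; first by rewrite [leRHS]big_geq // big1.
rewrite (@big_cat_nat _ _ _ J.+1) ?(ltnW JV) //= gerDl.
rewrite big_nat_cond big1 // => j; rewrite andbT => /andP[Jj _].
exact: GJ.
Qed.

(** The pairs ([j], divisor [e] of [j]) embed into a box through
    [j = e * m]. *)
Lemma sum_over_divisors_le (R : realType) (J : nat) (F : nat -> nat -> R) :
  (forall e m, (0 < e)%N -> (0 < m)%N -> 0 <= F e m) ->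
  \sum_(1 <= j < J) \sum_(e <- divisors j) F e (j %/ e)%N <=
  \sum_(1 <= e < J) \sum_(1 <= m < J) F e m.
Proof.
move=> F0.
have -> : \sum_(1 <= j < J) \sum_(e <- divisors j) F e (j %/ e)%N =
   \sum_(1 <= j < J) \sum_(1 <= e < J | (e %| j)%N) F e (j %/ e)%N.
  apply: eq_big_nat => j /andP[j0 jJ]; rewrite -[RHS]big_filter.
  apply: perm_big; apply: uniq_perm.
  - exact: divisors_uniq.
  - by rewrite filter_uniq ?iota_uniq.
  - move=> e; rewrite mem_filter mem_index_iota -dvdn_divisors //.
    apply/idP/andP => [ej|[]//]; split=> //.
    by rewrite (dvdn_gt0 j0 ej) (leq_ltn_trans (dvdn_leq j0 ej)).
rewrite (exchange_big_dep_nat xpredT) //=.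
apply: ler_sum_nat => e /andP[e0 eJ].
apply: (le_trans (y := \sum_(1 <= v < J | (e %| v)%N)
           (fun m => if (m < J)%N then F e m else 0) (v %/ e)%N)).
  rewrite big_nat_cond [leRHS]big_nat_cond; apply: ler_sum => v.
  by move=> /andP[/andP[v0 vJ] _]; rewrite (leq_ltn_trans (leq_div _ _)).
apply: (le_trans (sum_multiples_le (J := J)
    (G := fun m => if (m < J)%N then F e m else 0) _ e0 _ _)).
- by move=> m m0; case: ifP => // _; exact: F0.
- by move=> m; rewrite leqNgt => /negbTE ->.
- by apply: ler_sum_nat => m /andP[_ ->].
Qed.

(** Cauchy-Schwarz for a splitting that is only known through the squares of
    the terms, which avoids square roots of [p] and [q]. *)
Lemma sqr_sum_le (R : realType) (I : Type) (s : seq I) (P : pred I)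
    (u p q : I -> R) :
  (forall i, P i -> 0 <= p i) -> (forall i, P i -> 0 <= q i) ->
  (forall i, P i -> (u i) ^+ 2 <= p i * q i) ->
  (\sum_(i <- s | P i) u i) ^+ 2 <=
  (\sum_(i <- s | P i) p i) * (\sum_(i <- s | P i) q i).
Proof.
move=> p0 q0 upq.
have twice : \sum_(i <- s | P i) \sum_(j <- s | P j) (u i * u j) *+ 2 <=
    \sum_(i <- s | P i) \sum_(j <- s | P j) (p i * q j + p j * q i).
  apply: ler_sum => i Pi; apply: ler_sum => j Pj.
  have pi := p0 i Pi; have pj := p0 j Pj; have qi := q0 i Pi.
  have qj := q0 j Pj; have ui := upq i Pi; have uj := upq j Pj.
  have rhs0 : 0 <= p i * q j + p j * q i by rewrite addr_ge0 ?mulr_ge0.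
  have [uij|uij] := leP (u i * u j *+ 2) 0; first exact: le_trans uij rhs0.
  rewrite -(@ler_pXn2r _ 2) ?nnegrE // ?(ltW uij) //.
  have uu : (u i * u j *+ 2) ^+ 2 <= 4 * ((p i * q i) * (p j * q j)).
    have -> : (u i * u j *+ 2) ^+ 2 = 4 * (u i ^+ 2 * u j ^+ 2) by ring.
    by rewrite ler_pM2l ?ltr0n // ler_pM ?sqr_ge0.
  apply: le_trans uu _; rewrite -subr_ge0.
  have -> : (p i * q j + p j * q i) ^+ 2 - 4 * (p i * q i * (p j * q j)) =
    (p i * q j - p j * q i) ^+ 2 by ring.
  exact: sqr_ge0.
have sq : (\sum_(i <- s | P i) u i) ^+ 2 =
    \sum_(i <- s | P i) \sum_(j <- s | P j) u i * u j.
  by rewrite expr2 mulr_suml; apply: eq_bigr => i _; rewrite mulr_sumr.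
have pq : (\sum_(i <- s | P i) p i) * (\sum_(i <- s | P i) q i) =
    \sum_(i <- s | P i) \sum_(j <- s | P j) p i * q j.
  by rewrite mulr_suml; apply: eq_bigr => i _; rewrite mulr_sumr.
rewrite sq pq -(@ler_pMn2r _ 2%N) //.
move: twice; under eq_bigr do rewrite sumrMnl.
rewrite sumrMnl => /le_trans -> //.
under eq_bigr do rewrite big_split /=.
rewrite big_split /= mulr2n lerD2l exchange_big /=.
by apply: ler_sum => i _; apply: ler_sum.
Qed.

(** * Multiplicative weights and dilated coefficients *)

(** These are the only properties of [d^(1-2s)] that the estimates of square
    norms use. *)
Definition mult_weight (R : realType) (w : nat -> R) (Z : R) : Prop :=
  [/\ forall d, 0 <= w d, forall d e, w (d * e)%N = w d * w e
    & forall E, \sum_(1 <= e < E) w e / e%:R <= Z].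

Definition divisor_sum (R : realType) (w : nat -> R) (k : nat) : R :=
  \sum_(d <- divisors k) w d.

Lemma divisor_sum_ge0 (R : realType) (w : nat -> R) (Z : R) k :
  mult_weight w Z -> 0 <= divisor_sum w k.
Proof. by case=> w0 _ _; apply: sumr_ge0. Qed.

Lemma mult_weight_bound_ge0 (R : realType) (w : nat -> R) (Z : R) :
  mult_weight w Z -> 0 <= Z.
Proof. by case=> _ _ /(_ 0%N); rewrite big_geq. Qed.

Lemma harmonic_sum_le (R : realType) (P : nat) :
  \sum_(1 <= j < 2 ^ P) (j%:R : R)^-1 <= P%:R.
Proof.
elim: P => [|P IH]; first by rewrite expn0 big_geq.
rewrite (@big_cat_nat _ _ _ (2 ^ P)) /= ?expn_gt0 ?leq_exp2l //.
rewrite -natr1 lerD //.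
apply: (@le_trans _ _ (\sum_(2 ^ P <= j < 2 ^ P.+1) ((2 ^ P)%:R : R)^-1)).
  apply: ler_sum_nat => j /andP[Pj _].
  have P0 : (0 < 2 ^ P)%N by rewrite expn_gt0.
  by rewrite lef_pV2 ?posrE ?ltr0n ?ler_nat // (leq_trans P0).
rewrite sumr_const_nat expnS mul2n -addnn addnK -[leLHS]mulr_natr mulVf //.
Qed.

(** Writing [j = e * m] separates the double sum into the bounded sum of
    [w e / e] and a harmonic sum, which is the only source of a logarithm. *)
Lemma sum_divisor_sum_le (R : realType) (w : nat -> R) (Z : R) (P : nat) :
  mult_weight w Z ->
  \sum_(1 <= j < 2 ^ P) divisor_sum w j / j%:R <= Z * P%:R.
Proof.
move=> hw; have [w0 _ wZ] := hw.
have -> : \sum_(1 <= j < 2 ^ P) divisor_sum w j / j%:R =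
    \sum_(1 <= j < 2 ^ P) \sum_(e <- divisors j)
      w e / e%:R * ((j %/ e)%N%:R)^-1.
  apply: eq_big_nat => j /andP[j0 _]; rewrite /divisor_sum mulr_suml.
  rewrite big_seq [RHS]big_seq; apply: eq_bigr => e.
  rewrite -dvdn_divisors // => ej.
  by rewrite -{1}(divnK ej) natrM invfM mulrA mulrAC.
apply: le_trans (@sum_over_divisors_le _ _
    (fun e m => w e / e%:R * (m%:R)^-1) _) _.
  by move=> e m _ _; rewrite !mulr_ge0 ?invr_ge0 ?ler0n.
under eq_bigr do rewrite -mulr_sumr.
rewrite -mulr_suml ler_pM ?harmonic_sum_le ?wZ ?sumr_ge0 // => i _.
by rewrite mulr_ge0 ?invr_ge0.
Qed.

(** Write a divisor of [k * j] as [d * e] and [j = e * m] with [d] a divisor of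
    [k]. The constraint becomes [m <= 2 * d <= 4 * m], so that the harmonic sum
    over [m] runs over a bounded ratio only and stays below 4. *)
Lemma sum_divisor_sum_block_le (R : realType) (w : nat -> R) (Z : R)
    (k J : nat) :
  mult_weight w Z -> (0 < k)%N ->
  \sum_(1 <= j < J) (\sum_(d <- divisors (k * j) | (j <= 2 * d <= 4 * j)%N) w d)
     / j%:R <= 4 * Z * divisor_sum w k.
Proof.
move=> hw k0; have [w0 wM wZ] := hw.
pose ind (d m : nat) : R := if (m <= 2 * d <= 4 * m)%N then 1 else 0.
have ind0 d m : 0 <= ind d m by rewrite /ind; case: ifP.
apply: (@le_trans _ _ (\sum_(d <- divisors k) \sum_(1 <= j < J)
    \sum_(e <- divisors j)
      w d * (w e / e%:R) * (ind d (j %/ e)%N / (j %/ e)%N%:R))).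
  rewrite [leRHS]exchange_big /=.
  apply: ler_sum_nat => j /andP[j0 _].
  rewrite big_mkcond /= mulr_suml.
  pose phi d := (if (j <= 2 * d <= 4 * j)%N then w d else 0) / j%:R.
  apply: (@le_trans _ _ (\sum_(d <- divisors k) \sum_(e <- divisors j)
      phi (d * e)%N)).
    apply: (@sum_divisors_mul_le _ _ _ phi) => // d.
    by rewrite /phi mulr_ge0 ?invr_ge0 //; case: ifP.
  apply: ler_sum => d _.
  rewrite big_seq [leRHS]big_seq; apply: ler_sum => e.
  rewrite -dvdn_divisors // => ej.
  have e0 : (0 < e)%N := dvdn_gt0 j0 ej.
  have -> : phi (d * e)%N =
      ind d (j %/ e)%N * (w d * w e) / (e%:R * (j %/ e)%N%:R).
    rewrite /phi /ind -natrM [(e * _)%N]mulnC divnK // -wM.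
    have -> : (j <= 2 * (d * e) <= 4 * j)%N =
               (j %/ e <= 2 * d <= 4 * (j %/ e))%N.
      rewrite -(leq_pmul2r (m := e) (n1 := (j %/ e)%N)) //.
      rewrite -(leq_pmul2r (m := e) (n1 := (2 * d)%N)) //.
      by rewrite -!mulnA divnK.
    by case: ifP; rewrite ?mul1r ?mul0r.
  by rewrite invfM le_eqVlt; apply/orP; left; apply/eqP; ring.
rewrite /divisor_sum mulr_sumr big_seq [leRHS]big_seq.
apply: ler_sum => d; rewrite -dvdn_divisors // => dk.
have d0 : (0 < d)%N := dvdn_gt0 k0 dk.
apply: le_trans (@sum_over_divisors_le _ _
    (fun e m => w d * (w e / e%:R) * (ind d m / m%:R)) _) _.
  by move=> e m _ _; rewrite !mulr_ge0 ?invr_ge0 ?ler0n.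
under eq_bigr do rewrite -mulr_sumr.
rewrite -mulr_suml -mulr_sumr.
have -> : 4 * Z * w d = w d * Z * 4 by ring.
have s0 : 0 <= \sum_(1 <= i < J) w i / i%:R.
  by apply: sumr_ge0 => i _; rewrite mulr_ge0 ?invr_ge0.
rewrite ler_pM ?mulr_ge0 //.
- by apply: sumr_ge0 => i _; rewrite mulr_ge0 ?invr_ge0.
- by rewrite ler_wpM2l.
apply: (@le_trans _ _ (\sum_(1 <= m < J | (m < (2 * d).+1)%N) 2 / d%:R)).
  rewrite [leRHS]big_mkcond; apply: ler_sum_nat => m /andP[m0 _].
  rewrite /ind; case: ifP => [/andP[m2d d2m]|_]; last first.
    by rewrite mul0r; case: ifP => // _; rewrite divr_ge0.
  rewrite ltnS m2d mul1r -[2]invrK -invfM lef_pV2 ?posrE ?mulr_gt0 ?ltr0n //.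
  rewrite ler_pdivrMl ?ltr0n // -natrM ler_nat.
  by move: d2m; rewrite (_ : 4 = 2 * 2)%N // -mulnA leq_pmul2l.
apply: (@le_trans _ _ (\sum_(1 <= m < (2 * d).+1) 2 / d%:R)).
  rewrite [leLHS](eq_bigr (fun=> (2 / d%:R) *+ 1)) //.
  have c0 : 0 <= 2 / d%:R :> R by rewrite divr_ge0.
  rewrite big_mkcond /=.
  have [JD|DJ] := leqP J (2 * d).+1.
    rewrite (@big_cat_nat _ _ _ (maxn 1 J) 1 (2 * d).+1) ?leq_maxl //=; last first.
      by rewrite geq_max JD.
    apply: ler_wpDr; first by apply: sumr_ge0.
    case: (leqP J 1) => J1; first by rewrite !big_geq.
    by apply: ler_sum => i _; case: ifP.
  rewrite (@big_cat_nat _ _ _ (2 * d).+1) //=; last exact: ltnW.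
  rewrite [X in _ + X]big_nat_cond [X in _ + X]big1 ?addr0; last first.
    by move=> i; rewrite andbT => /andP[+ _]; rewrite leqNgt => /negbTE ->.
  by apply: ler_sum => i _; case: ifP.
rewrite sumr_const_nat subSS subn0 -[leLHS]mulr_natr natrM.
have dn0 : (d%:R : R) != 0 by rewrite pnatr_eq0 -lt0n.
by rewrite le_eqVlt; apply/orP; left; apply/eqP; field.
Qed.

(** As [k] is injective, the quotients [v / k n] are distinct divisors
    of [v]. *)
Lemma sum_quotients_le (R : realType) (w : nat -> R) (k : nat -> nat)
    (I P : pred nat) (N v : nat) :
  (forall d, 0 <= w d) -> {in [pred n | (0 < n)%N] &, injective k} ->
  (0 < v)%N ->
  (forall n, (0 < n)%N -> I n -> (k n %| v)%N -> P (v %/ k n)%N) ->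
  \sum_(1 <= n < N | I n && (k n %| v)%N) w (v %/ k n)%N <=
  \sum_(d <- divisors v | P d) w d.
Proof.
move=> w0 kinj v0 IP.
pose phi d := if P d then w d else 0.
rewrite [leRHS]big_mkcond -/phi.
have -> : \sum_(1 <= n < N | I n && (k n %| v)%N) w (v %/ k n)%N =
    \sum_(1 <= n < N | I n && (k n %| v)%N) phi (v %/ k n)%N.
  rewrite big_nat_cond [RHS]big_nat_cond; apply: eq_bigr => n.
  by move=> /andP[/andP[n0 _] /andP[In kn]]; rewrite /phi IP.
apply: (ler_sum_image (g := fun n => v %/ k n)%N) => //.
- by move=> d; rewrite /phi; case: ifP.
- exact: iota_uniq.
- exact: divisors_uniq.
- move=> m n; rewrite !mem_filter !mem_index_iota.
  move=> /andP[/andP[_ km] /andP[m0 _]] /andP[/andP[_ kn] /andP[n0 _]] mn.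
  apply: kinj; rewrite ?inE //; apply/eqP.
  have q0 : (0 < v %/ k m)%N by rewrite divn_gt0 ?(dvdn_gt0 v0 km) // (dvdn_leq v0 km).
  by rewrite -(eqn_pmul2l q0) [in X in _ == X]mn divnK // divnK.
- by move=> n _ /andP[_ kn]; rewrite -dvdn_divisors // dvdn_div.
Qed.

(** The coefficient of [sin (2 pi v x)] in the sum over [n] and [j] of
    [b n j * sin (2 pi j (k n x))]. *)
Definition dilated_coef (R : realType) (k : nat -> nat) (N : nat)
    (b : nat -> nat -> R) (v : nat) : R :=
  \sum_(1 <= n < N | (k n %| v)%N) b n (v %/ k n)%N.

(** Each coefficient is split by Cauchy-Schwarz into the part [x * mu / j] and
    the part [w]; in the second one the sum runs over all the ways [k n' * j']
    of writing the same frequency. *)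
Lemma dilated_coef_sqr_le (R : realType) (w : nat -> R) (k : nat -> nat)
    (N J V : nat) (I : pred nat) (b mu : nat -> nat -> R) (x : nat -> R) :
  (forall d, 0 <= w d) -> (forall n, (0 < n)%N -> (0 < k n)%N) ->
  (forall n, 0 <= x n) -> (forall n j, 0 <= mu n j) ->
  (forall n j, (0 < n)%N -> (0 < j)%N -> I n -> (j < J)%N ->
     (b n j) ^+ 2 <= x n * mu n j * (w j / j%:R)) ->
  (forall n j, ~~ (I n && (j < J)%N) -> b n j = 0) ->
  \sum_(1 <= v < V) (dilated_coef k N b v) ^+ 2 <=
  \sum_(1 <= n < N | I n) x n * \sum_(1 <= j < J) mu n j / j%:R *
    \sum_(1 <= n' < N | I n' && (k n' %| k n * j)%N) w (k n * j %/ k n')%N.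
Proof.
move=> w0 k0 x0 mu0 bmu bI.
pose mu' n j := if (j < J)%N then mu n j / j%:R else 0.
have mu'0 n j : 0 <= mu' n j.
  by rewrite /mu'; case: ifP => // _; rewrite mulr_ge0 ?invr_ge0.
pose tau v := \sum_(1 <= n' < N | I n' && (k n' %| v)%N) w (v %/ k n')%N.
have tau0 v : 0 <= tau v by apply: sumr_ge0.
apply: (@le_trans _ _ (\sum_(1 <= v < V)
    \sum_(1 <= n < N | I n && (k n %| v)%N)
      x n * (mu' n (v %/ k n)%N * tau (k n * (v %/ k n))%N))).
  apply: ler_sum_nat => v /andP[v0 _].
  have -> : dilated_coef k N b v =
      \sum_(1 <= n < N | I n && (k n %| v)%N) b n (v %/ k n)%N.
    rewrite /dilated_coef (bigID I) /= addrC big1 ?add0r.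
      by apply: eq_bigl => n; rewrite andbC.
    by move=> n /andP[_ /negbTE nI]; apply: bI; rewrite nI.
  rewrite [leLHS](_ : _ = (\sum_(1 <= n < N | [&& (1 <= n < N)%N, I n
      & (k n %| v)%N]) b n (v %/ k n)%N) ^+ 2); last by rewrite -big_nat_cond.
  apply: le_trans (sqr_sum_le (p := fun n => x n * mu' n (v %/ k n)%N)
     (q := fun n => w (v %/ k n)%N) _ _ _ _) _.
  - by move=> n _; rewrite mulr_ge0.
  - by [].
  - move=> n /andP[/andP[n0 _] /andP[In kn]]; rewrite /mu'.
    case: ifP => jJ; last by rewrite bI ?jJ ?andbF // expr0n /= mulr0 mul0r.
    have j0 : (0 < v %/ k n)%N by rewrite divn_gt0 ?k0 // dvdn_leq.
    apply: le_trans (bmu _ _ n0 j0 In jJ) _.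
    by rewrite le_eqVlt; apply/orP; left; apply/eqP; ring.
  rewrite -!big_nat_cond -/(tau v) mulr_suml le_eqVlt; apply/orP; left; apply/eqP.
  apply: eq_bigr => n /andP[_ kn].
  by rewrite mulrA mulnC divnK.
rewrite (exchange_big_dep_nat I) /=; last by move=> ? ? _ _ _ /andP[].
rewrite big_nat_cond [leRHS]big_nat_cond.
apply: ler_sum => n /andP[/andP[n0 _] In].
rewrite -mulr_sumr ler_wpM2l //.
under [leLHS]eq_bigl => v do rewrite In /=.
apply: le_trans (sum_multiples_le (J := J)
    (G := fun j => mu' n j * tau (k n * j)%N) _ _ _ _) _.
- exact: k0.
- by move=> j _; rewrite mulr_ge0.
- by move=> j; rewrite /mu' leqNgt => /negbTE ->; rewrite mul0r.
- by apply: ler_sum_nat => j /andP[_ jJ]; rewrite /mu' jJ.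
Qed.

(** All the ways of writing [k n * j] as [k n' * j'] are counted here: the
    [j'] are bounded by the divisors of [k n * j], and [w] is
    multiplicative. *)
Lemma dilated_coef_sqr_le_log (R : realType) (w : nat -> R) (Z : R)
    (k : nat -> nat) (N J V : nat) (b mu : nat -> nat -> R) (x : nat -> R) :
  mult_weight w Z -> (forall n, (0 < n)%N -> (0 < k n)%N) ->
  {in [pred n | (0 < n)%N] &, injective k} ->
  (forall n, 0 <= x n) -> (forall n j, 0 <= mu n j) ->
  (forall n j, (0 < n)%N -> (0 < j)%N -> (j < J)%N ->
     (b n j) ^+ 2 <= x n * mu n j * (w j / j%:R)) ->
  (forall n j, (J <= j)%N -> b n j = 0) ->
  \sum_(1 <= v < V) (dilated_coef k N b v) ^+ 2 <=
  \sum_(1 <= n < N) x n * divisor_sum w (k n) *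
     \sum_(1 <= j < J) mu n j * (divisor_sum w j / j%:R).
Proof.
move=> hw k0 kinj x0 mu0 bmu bI; have [w0 wM wZ] := hw.
apply: le_trans (dilated_coef_sqr_le (w := w) (I := xpredT) (J := J) (x := x)
  (mu := mu) N V w0 k0 x0 mu0 _ _) _ => /=.
- by move=> n j n0 j0 _; exact: bmu.
- by move=> n j; rewrite -leqNgt; exact: bI.
apply: ler_sum_nat => n /andP[n0 _]; rewrite -mulrA ler_wpM2l //.
rewrite mulr_sumr; apply: ler_sum_nat => j /andP[j0 jJ].
rewrite mulrCA -!mulrA ler_wpM2l // mulrC mulrA ler_wpM2r ?invr_ge0 //.
have kj0 : (0 < k n * j)%N by rewrite muln_gt0 k0.
apply: le_trans (sum_quotients_le (I := xpredT) (P := xpredT) N w0 kinj kj0 _) _.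
  by [].
apply: le_trans (sum_divisors_mul_le w0 (k0 _ n0) j0) _.
rewrite /divisor_sum mulr_suml; apply: ler_sum => d _.
by rewrite mulr_sumr; apply: ler_sum => e _; rewrite wM.
Qed.

(** If [k n] and [k n'] differ by a factor less than 2, so do [j] and [j'] when
    [k n * j = k n' * j']. This is what saves the logarithm. *)
Lemma dilated_coef_sqr_le_block (R : realType) (w : nat -> R) (Z : R)
    (k : nat -> nat) (N J V K : nat) (I : pred nat) (b : nat -> nat -> R)
    (x : nat -> R) :
  mult_weight w Z -> (forall n, (0 < n)%N -> (0 < k n)%N) ->
  {in [pred n | (0 < n)%N] &, injective k} ->
  (forall n, 0 <= x n) ->
  (forall n, I n -> (K <= k n < 2 * K)%N) ->
  (forall n j, (0 < n)%N -> (0 < j)%N -> I n -> (j < J)%N ->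
     (b n j) ^+ 2 <= x n * (w j / j%:R)) ->
  (forall n j, ~~ (I n && (j < J)%N) -> b n j = 0) ->
  \sum_(1 <= v < V) (dilated_coef k N b v) ^+ 2 <=
  4 * Z * \sum_(1 <= n < N | I n) x n * divisor_sum w (k n).
Proof.
move=> hw k0 kinj x0 kI bmu bI; have [w0 wM wZ] := hw.
apply: le_trans (dilated_coef_sqr_le (w := w) (I := I) (J := J) (x := x)
  (mu := fun _ _ => 1) N V w0 k0 x0 _ _ _) _ => //=.
  by move=> n j n0 j0 In jJ; rewrite mulr1; exact: bmu.
rewrite mulr_sumr big_nat_cond [leRHS]big_nat_cond.
apply: ler_sum => n /andP[/andP[n0 _] In].
rewrite mulrCA ler_wpM2l //.
apply: le_trans (sum_divisor_sum_block_le J hw (k0 _ n0)).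
apply: ler_sum_nat => j /andP[j0 jJ].
rewrite mul1r mulrC ler_wpM2r ?invr_ge0 //.
have kj0 : (0 < k n * j)%N by rewrite muln_gt0 k0.
apply: sum_quotients_le => // n' n'0 In' kn'.
have /andP[] := kI _ In; have /andP[] := kI _ In' => a1 a2 a3 a4.
have kn'0 := k0 _ n'0; set d := (_ %/ _)%N.
have E : (k n * j = d * k n')%N by rewrite divnK.
apply/andP; split; rewrite -(leq_pmul2r kn'0) -mulnA -?E.
  by nia.
by nia.
Qed.

(** * The Rademacher-Menshov inequality, pointwise *)

Definition dyadic_sum (R : realType) (q : nat -> nat -> R) (o p i : nat) : R :=
  \sum_(0 <= l < 2 ^ (p - i)) q (o + l * 2 ^ i)%N (o + l.+1 * 2 ^ i)%N.

(** For [q a b] the square of the sum of [u] over [[a, b)], this dominates the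
    squares of all partial sums of [u]; see [partial_sum_sqr_le]. Leaving [q]
    arbitrary makes it possible to integrate the expression term by term. *)
Definition rm_sum (R : realType) (q : nat -> nat -> R) (T : nat) : R :=
  \sum_(0 <= p < T) (4 * (p.+1%:R) ^+ 2 * q (2 ^ p)%N (2 ^ p.+1)%N
    + 2 * p%:R * \sum_(0 <= i < p) dyadic_sum q (2 ^ p) p i).

Lemma sum_consecutive_blocks (R : realType) (v : nat -> R) (o h L : nat) :
  \sum_(0 <= l < L) \sum_(o + l * h <= n < o + l.+1 * h) v n =
  \sum_(o <= n < o + L * h) v n.
Proof.
elim: L => [|L IH]; first by rewrite mul0n addn0 !big_geq.
rewrite big_nat_recr //= IH -big_cat_nat ?leq_addr //.
by rewrite leq_add2l leq_mul2r leqnSn orbT.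
Qed.

Lemma sum_dyadic_blocks (R : realType) (v : nat -> R) (T : nat) :
  \sum_(0 <= p < T) \sum_(2 ^ p <= n < 2 ^ p.+1) v n = \sum_(1 <= n < 2 ^ T) v n.
Proof.
elim: T => [|T IH]; first by rewrite !big_geq.
by rewrite big_nat_recr //= IH -big_cat_nat ?expn_gt0 // leq_exp2l.
Qed.

(** Telescoping, through the sharper bound [2 - 1 / p]. *)
Lemma sum_squares_inv_le (R : realType) (p : nat) :
  \sum_(0 <= i < p) ((i.+1%:R : R) ^+ 2)^-1 <= 2.
Proof.
case: p => [|p]; first by rewrite big_geq.
suff : \sum_(0 <= i < p.+1) ((i.+1%:R : R) ^+ 2)^-1 <= 2 - (p.+1%:R)^-1.
  by move=> /le_trans; apply; rewrite lerBlDr lerDl invr_ge0.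
elim: p => [|p IH]; first by rewrite big_nat1 expr1n invr1; lra.
rewrite big_nat_recr //=; apply: (le_trans (lerD IH (lexx _))).
have p0 : 0 < p.+1%:R :> R by rewrite ltr0n.
have -> : p.+2%:R = p.+1%:R + 1 :> R by rewrite natr1.
set x := p.+1%:R : R in p0 *.
have x1 : 0 < x + 1 by rewrite addr_gt0.
rewrite -subr_ge0.
have -> : 2 - (x + 1)^-1 - (2 - x^-1 + ((x + 1) ^+ 2)^-1) =
   (x * (x + 1) ^+ 2)^-1 by field; rewrite !gt_eqF.
by rewrite invr_ge0 mulr_ge0 ?exprn_ge0 ?ltW.
Qed.

(** The binary expansion of [M] cuts [[o, o + M)] into dyadic intervals of
    distinct lengths, at most one at each level. *)
Lemma dyadic_chain_le (R : realType) (u : nat -> R) (p o M : nat) :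
  (M < 2 ^ p)%N ->
  `|\sum_(o <= n < o + M) u n| <=
  \sum_(0 <= i < p)
     Num.sqrt (dyadic_sum (fun a b => (\sum_(a <= n < b) u n) ^+ 2) o p i).
Proof.
pose q a b := (\sum_(a <= n < b) u n) ^+ 2; rewrite -/q.
have q0 a b : 0 <= q a b by exact: sqr_ge0.
have d0 o' p' i : 0 <= dyadic_sum q o' p' i by exact: sumr_ge0.
elim: p o M => [|p IH] o M.
  by rewrite expn0 ltnS leqn0 => /eqP ->; rewrite addn0 !big_geq // normr0.
move=> Mp; rewrite big_nat_recr //=.
have split_level i : (i <= p)%N -> dyadic_sum q o p.+1 i =
    dyadic_sum q o p i + dyadic_sum q (o + 2 ^ p) p i.
  move=> ip; rewrite /dyadic_sum subSn // expnS mul2n -addnn.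
  rewrite (@big_cat_nat _ _ _ (2 ^ (p - i))) ?leq_addr //=; congr (_ + _).
  rewrite -{1}[(2 ^ (p - i))%N]add0n big_addn addnK.
  apply: eq_bigr => l _; congr (q _ _).
    by rewrite mulnDl -expnD subnK // [(l * _ + _)%N]addnC addnA.
  by rewrite -addSn mulnDl -expnD subnK // [(l.+1 * _ + _)%N]addnC addnA.
have [Mp'|pM] := ltnP M (2 ^ p).
  apply: (le_trans (IH o M Mp')); apply: ler_wpDr; first exact: sqrtr_ge0.
  apply: ler_sum_nat => i /andP[_ ip].
  by rewrite ler_sqrt // split_level ?lerDl // ltnW.
rewrite (@big_cat_nat _ _ _ (o + 2 ^ p)) ?leq_addr ?leq_add2l //=.
apply: (le_trans (ler_normD _ _)); rewrite addrC lerD //; last first.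
  have -> : (o + M = (o + 2 ^ p) + (M - 2 ^ p))%N by rewrite -addnA subnKC.
  apply: (le_trans (IH _ _ _)).
    by rewrite ltn_subLR // addnn -mul2n -expnS.
  apply: ler_sum_nat => i /andP[_ ip].
  by rewrite ler_sqrt // split_level ?lerDr // ltnW.
rewrite -sqrtr_sqr ler_sqrt // split_level //.
apply: ler_wpDr => //; rewrite /dyadic_sum subnn expn0 big_nat1.
by rewrite mul0n addn0 mul1n.
Qed.

(** An initial segment consists of full blocks [[2^i, 2^(i+1))] and of an
    initial part of the next block. The full blocks are summed by
    Cauchy-Schwarz with the weights [(i+1)^-2], the last part is a dyadic
    chain. Thus the block [p] is charged [(p+1)^2], independently of the
    length [2^T] of the sum. *)
Lemma partial_sum_sqr_le (R : realType) (u : nat -> R) (T M : nat) :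
  (M < 2 ^ T)%N ->
  (\sum_(1 <= n < M) u n) ^+ 2 <=
  rm_sum (fun a b => (\sum_(a <= n < b) u n) ^+ 2) T.
Proof.
pose q a b := (\sum_(a <= n < b) u n) ^+ 2; rewrite -/q => MT.
have q0 a b : 0 <= q a b by exact: sqr_ge0.
have d0 o' p' i : 0 <= dyadic_sum q o' p' i by exact: sumr_ge0.
have dd0 p : 0 <= 2 * p%:R * \sum_(0 <= i < p) dyadic_sum q (2 ^ p) p i.
  by rewrite !mulr_ge0 ?sumr_ge0.
have qq0 p : 0 <= 4 * (p.+1%:R) ^+ 2 * q (2 ^ p)%N (2 ^ p.+1)%N.
  by apply: mulr_ge0 => //; apply: mulr_ge0 => //; exact: exprn_ge0.
case: M MT => [|M] MT.
  rewrite big_geq // expr0n; apply: sumr_ge0 => p _; exact: addr_ge0.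
have := @trunc_log_bounds 2 M.+1 isT isT; set p := trunc_log 2 M.+1 => /=.
case/andP=> pM Mp.
have pT : (p < T)%N by rewrite -(ltn_exp2l (m := 2)) // (leq_ltn_trans pM).
rewrite (@big_cat_nat _ _ _ (2 ^ p)) ?expn_gt0 //= -sum_dyadic_blocks.
set a := \sum_(0 <= _ < _) _; set b := \sum_(_ <= _ < _) _.
have -> : rm_sum q T =
    \sum_(0 <= p < T) 4 * (p.+1%:R) ^+ 2 * q (2 ^ p)%N (2 ^ p.+1)%N +
    \sum_(0 <= p < T) 2 * p%:R * \sum_(0 <= i < p) dyadic_sum q (2 ^ p) p i.
  by rewrite /rm_sum big_split.
have ha : 2 * a ^+ 2 <=
    \sum_(0 <= p < T) 4 * (p.+1%:R) ^+ 2 * q (2 ^ p)%N (2 ^ p.+1)%N.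
  rewrite (@big_cat_nat _ _ _ p) //= ?(ltnW pT) //.
  apply: ler_wpDr; first exact: sumr_ge0.
  apply: (@le_trans _ _ (2 * ((\sum_(0 <= i < p) ((i.+1%:R : R) ^+ 2)^-1) *
     \sum_(0 <= i < p) i.+1%:R ^+ 2 * q (2 ^ i)%N (2 ^ i.+1)%N))).
    rewrite ler_wpM2l //; apply: sqr_sum_le => i _.
    - by rewrite invr_ge0 exprn_ge0.
    - by apply: mulr_ge0 => //; exact: exprn_ge0.
    - by rewrite mulrA mulVf ?mul1r // expf_neq0 // pnatr_eq0.
  have -> : \sum_(0 <= i < p) 4 * i.+1%:R ^+ 2 * q (2 ^ i)%N (2 ^ i.+1)%N =
     2 * (2 * \sum_(0 <= i < p) i.+1%:R ^+ 2 * q (2 ^ i)%N (2 ^ i.+1)%N).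
    by rewrite mulrA mulr_sumr; apply: eq_bigr => i _; ring.
  rewrite ler_wpM2l // ler_wpM2r ?sum_squares_inv_le //.
  by apply: sumr_ge0 => i _; apply: mulr_ge0 => //; exact: exprn_ge0.
have hb : 2 * b ^+ 2 <=
    \sum_(0 <= p < T) 2 * p%:R * \sum_(0 <= i < p) dyadic_sum q (2 ^ p) p i.
  rewrite big_mkord (bigD1 (Ordinal pT)) //= ler_wpDr ?sumr_ge0 //.
  rewrite -mulrA ler_wpM2l //.
  have MpE : (M.+1 = 2 ^ p + (M.+1 - 2 ^ p))%N by rewrite subnKC.
  have Mlt : (M.+1 - 2 ^ p < 2 ^ p)%N by rewrite ltn_subLR // addnn -mul2n -expnS.
  have := dyadic_chain_le u (2 ^ p) Mlt; rewrite -MpE -/b -/q => hb.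
  rewrite -(real_normK (num_real b)).
  have hp : p%:R = \sum_(0 <= i < p) (1 : R) by rewrite sumr_const_nat subn0.
  rewrite hp.
  apply: (@le_trans _ _ ((\sum_(0 <= i < p)
     Num.sqrt (dyadic_sum q (2 ^ p) p i)) ^+ 2)).
    by rewrite ler_pXn2r // nnegrE ?sumr_ge0 // => i _; exact: sqrtr_ge0.
  by apply: sqr_sum_le => i _ //; rewrite mul1r sqr_sqrtr.
apply: le_trans (lerD ha hb).
rewrite -subr_ge0 (_ : _ - _ = (a - b) ^+ 2) ?sqr_ge0 //; ring.
Qed.

(** The intervals of one level tile the block, so that each of the [p] levels
    contributes the same amount. *)
Lemma rm_sum_additive_le (R : realType) (v : nat -> R) (T : nat) :
  (forall n, 0 <= v n) ->
  rm_sum (fun a b => \sum_(a <= n < b) v n) T <=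
  6 * \sum_(1 <= n < 2 ^ T) ((trunc_log 2 n).+1%:R) ^+ 2 * v n.
Proof.
move=> v0; rewrite -sum_dyadic_blocks mulr_sumr.
apply: ler_sum_nat => p _.
have level i : (i < p)%N ->
    dyadic_sum (fun a b => \sum_(a <= n < b) v n) (2 ^ p) p i =
    \sum_(2 ^ p <= n < 2 ^ p.+1) v n.
  move=> ip; rewrite /dyadic_sum sum_consecutive_blocks -expnD subnK ?(ltnW ip) //.
  by rewrite addnn -mul2n -expnS.
have -> : \sum_(0 <= i < p)
      dyadic_sum (fun a b => \sum_(a <= n < b) v n) (2 ^ p) p i =
    p%:R * \sum_(2 ^ p <= n < 2 ^ p.+1) v n.
  rewrite (eq_big_nat _ _ (F2 := fun=> \sum_(2 ^ p <= n < 2 ^ p.+1) v n)).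
    by rewrite sumr_const_nat subn0 mulr_natl.
  by move=> i /andP[_ ip]; exact: level.
set V := \sum_(_ <= _ < _) _.
have -> : \sum_(2 ^ p <= n < 2 ^ p.+1) (trunc_log 2 n).+1%:R ^+ 2 * v n =
    (p.+1%:R) ^+ 2 * V.
  rewrite /V mulr_sumr; apply: eq_big_nat => n hn.
  by rewrite (@trunc_log_eq 2 p).
have V0 : 0 <= V by exact: sumr_ge0.
have -> : 4 * p.+1%:R ^+ 2 * V + 2 * p%:R * (p%:R * V) =
  (4 * p.+1%:R ^+ 2 + 2 * (p%:R * p%:R)) * V by ring.
rewrite [leRHS]mulrA ler_wpM2r //.
have pp : p%:R * p%:R <= p.+1%:R ^+ 2 :> R.
  by rewrite -natrM -natrX ler_nat; nia.
lra.
Qed.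

Lemma ler_rm_sum (R : realType) (q q' : nat -> nat -> R) (T : nat) :
  (forall a b, q a b <= q' a b) -> rm_sum q T <= rm_sum q' T.
Proof.
move=> qq'; apply: ler_sum => p _; rewrite lerD ?ler_wpM2l //.
by apply: ler_sum => i _; apply: ler_sum.
Qed.

(** * Sine polynomials *)

Lemma is_derive_mull (R : realType) (f : R -> R) (c x df : R) :
  is_derive x 1 f df -> is_derive x 1 (fun y => c * f y) (c * df).
Proof. exact: is_deriveZ. Qed.

Lemma is_derive_mull_arg (R : realType) (f : R -> R) (c x df : R) :
  is_derive (c * x) 1 f df -> is_derive x 1 (fun y => f (c * y)) (c * df).
Proof.
move=> hf; have hg : is_derive x (1 : R) (fun y : R => c * y) c.
  by have := is_derive_mull c (is_derive_id x (1 : R)); rewrite mulr1.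
have := @is_derive1_comp _ f (fun y => c * y) x _ _ hf hg.
by rewrite mulrC.
Qed.

Lemma is_derive_bigsum (R : realType) (I : Type) (s : seq I) (P : pred I)
    (F : I -> R -> R) (f : I -> R) (x : R) :
  (forall i, is_derive x 1 (F i) (f i)) ->
  is_derive x 1 (fun y => \sum_(i <- s | P i) F i y) (\sum_(i <- s | P i) f i).
Proof.
move=> Ff; elim: s => [|i s IH].
  rewrite big_nil.
  rewrite (_ : (fun y => _) = cst 0); first exact: is_derive_cst.
  by apply/funext => y; rewrite big_nil.
rewrite big_cons; case: ifPn => Pi; last first.
  rewrite (_ : (fun y => _) = (fun y => \sum_(i <- s | P i) F i y)) //.
  by apply/funext => y; rewrite big_cons (negbTE Pi).
rewrite (_ : (fun y => _) = F i \+ (fun y => \sum_(i <- s | P i) F i y)) //.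
  exact: is_deriveD.
by apply/funext => y; rewrite big_cons Pi.
Qed.

Lemma continuous_bigsum (R : realType) (I : Type) (s : seq I) (P : pred I)
    (F : I -> R -> R) :
  (forall i, continuous (F i)) ->
  continuous (fun y => \sum_(i <- s | P i) F i y).
Proof.
move=> Fc; elim: s => [|i s IH].
  rewrite (_ : (fun y => _) = cst 0); first exact: cst_continuous.
  by apply/funext => y; rewrite big_nil.
case: (boolP (P i)) => Pi; last first.
  rewrite (_ : (fun y => _) = (fun y => \sum_(i <- s | P i) F i y)) //.
  by apply/funext => y; rewrite big_cons (negbTE Pi).
rewrite (_ : (fun y => _) = F i \+ (fun y => \sum_(i <- s | P i) F i y)) //.
  by move=> x; apply: continuousD; [exact: Fc|exact: IH].
by apply/funext => y; rewrite big_cons Pi.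
Qed.

Lemma integral_primitive (R : realType) (f F : R -> R) (a b : R) :
  a < b -> continuous f -> (forall x : R, is_derive x 1 F (f x)) ->
  (\int[lebesgue_measure]_(x in `[a, b]) (f x)%:E)%E = (F b - F a)%:E.
Proof.
move=> ab fc Ff.
have Fc : continuous F.
  by move=> x; apply/differentiable_continuous/derivable1_diffP; case: (Ff x).
rewrite (@continuous_FTC2 _ f F) //.
- exact: continuous_subspaceT.
- split.
  + by move=> x _; apply: ex_derive; exact: Ff.
  + by apply: cvg_at_right_filter; exact: Fc.
  + by apply: cvg_at_left_filter; exact: Fc.
- by move=> x _; rewrite derive1E; apply: derive_val; exact: Ff.
Qed.

Lemma continuous_sin_mull (R : realType) (c : R) :
  continuous (fun x => sin (c * x)).
Proof.
move=> x; apply: (@continuous_comp _ _ _ (fun y => c * y) sin).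
  exact: mulrl_continuous.
exact: continuous_sin.
Qed.

Lemma continuous_sine_psum (R : realType) (a : nat -> R) (N : nat) :
  continuous (sine_psum a N).
Proof.
apply: continuous_bigsum => j x.
apply: continuousM; first exact: cst_continuous.
exact: continuous_sin_mull.
Qed.

Lemma sin_nat_period (R : realType) (n : nat) : sin (2 * pi * n%:R) = 0 :> R.
Proof.
elim: n => [|n IH]; first by rewrite mulr0 sin0.
rewrite -[n.+1%:R]natr1 mulrDr mulr1 [X in sin (_ + X)]mulr_natl.
by rewrite sinD2pi.
Qed.

Lemma sin_int_period (R : realType) (n m : nat) (k : nat) :
  sin (2 * pi * (n%:R - m%:R) * k%:R) = 0 :> R.
Proof.
have [nm|mn] := leqP m n.
  by rewrite -natrB // -mulrA -natrM sin_nat_period.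
rewrite -opprB -natrB 1?ltnW // mulrN mulNr sinN -mulrA -natrM sin_nat_period.
by rewrite oppr0.
Qed.

Definition cos_primitive (R : realType) (k x : R) : R :=
  if k == 0 then x else sin (2 * pi * k * x) / (2 * pi * k).

Lemma is_derive_cos_primitive (R : realType) (k x : R) :
  is_derive x 1 (cos_primitive k) (cos (2 * pi * k * x)).
Proof.
rewrite /cos_primitive; have [->|k0] := eqVneq k 0.
  rewrite mulr0 mul0r cos0; exact: is_derive_id.
have p0 : 2 * pi * k != 0 :> R by rewrite !mulf_neq0 // gt_eqF ?pi_gt0.
rewrite (_ : (fun _ => _) =
    (fun y => (2 * pi * k)^-1 * sin (2 * pi * k * y))); last first.
  by apply/funext => y; rewrite mulrC.
rewrite -[cos _](mulKf p0); apply: is_derive_mull.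
exact: is_derive_mull_arg.
Qed.

Lemma cos_primitive_period (R : realType) (n k m : nat) :
  cos_primitive (n%:R - k%:R) m%:R - cos_primitive (n%:R - k%:R) (- m%:R) =
  (if n == k then 2 * m%:R else 0) :> R.
Proof.
rewrite /cos_primitive subr_eq0 eqr_nat; case: ifP => [_|_].
  by rewrite opprK -mulr2n mulr_natl.
by rewrite mulrN sinN sin_int_period !(mul0r, oppr0, addr0).
Qed.

Lemma mul_sin_sin (R : realType) (u v : R) :
  sin u * sin v = (cos (u - v) - cos (u + v)) / 2.
Proof. by rewrite cosB cosD; lra. Qed.

(** The sines are orthogonal on each of these intervals, hence estimates on the
    line follow without any translation. *)
Definition sym_itv (R : realType) (m : nat) : set R := `[- m%:R, m%:R]%classic.
Arguments sym_itv : clear implicits.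

Lemma integral_sine_psum_sqr (R : realType) (a : nat -> R) (N m : nat) :
  (0 < m)%N ->
  (\int[lebesgue_measure]_(x in sym_itv R m)
     ((sine_psum a N x) ^+ 2)%:E)%E =
  (m%:R * \sum_(1 <= j < N.+1) a j ^+ 2)%:E.
Proof.
move=> m0; pose F x := \sum_(1 <= i < N.+1) \sum_(1 <= j < N.+1)
  a i * a j / 2 * (cos_primitive (i%:R - j%:R) x
                   + - 1 * cos_primitive (i%:R - (0%N%:R - j%:R)) x).
have m0R : 0 < m%:R :> R by rewrite ltr0n.
have Fd (x : R) : is_derive x 1 F ((sine_psum a N x) ^+ 2).
  rewrite /F /sine_psum expr2 mulr_suml.
  apply: is_derive_bigsum => i; rewrite mulr_sumr.
  apply: is_derive_bigsum => j.
  have -> : a i * sin (2 * pi * i%:R * x) * (a j * sin (2 * pi * j%:R * x)) =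
      a i * a j / 2 * (cos (2 * pi * (i%:R - j%:R) * x)
         + - 1 * cos (2 * pi * (i%:R - (0%N%:R - j%:R)) * x)).
    rewrite mulrACA mul_sin_sin sub0r opprK.
    have -> : 2 * pi * (i%:R - j%:R) * x =
      2 * pi * i%:R * x - 2 * pi * j%:R * x by ring.
    have -> : 2 * pi * (i%:R + j%:R) * x =
      2 * pi * i%:R * x + 2 * pi * j%:R * x by ring.
    by field.
  apply: is_derive_mull; apply: is_deriveD; first exact: is_derive_cos_primitive.
  by apply: is_derive_mull; exact: is_derive_cos_primitive.
rewrite /sym_itv (integral_primitive _ _ Fd).
- congr (_%:E); rewrite /F -sumrB mulr_sumr; apply: eq_big_nat => i /andP[i0 iN].
  rewrite -sumrB (bigD1_seq i) ?mem_index_iota ?i0 ?iota_uniq //=.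
  rewrite big1 ?addr0.
    have := cos_primitive_period R i i m; rewrite eqxx => E1.
    have := cos_primitive_period R (i + i) 0 m.
    rewrite subr0 natrD addn_eq0 andbb eqn0Ngt i0 /= => E2.
    rewrite sub0r opprK; set p := cos_primitive _ _ in E1 *.
    have -> : cos_primitive (i%:R - i%:R) (- m%:R) = p - 2 * m%:R.
      by rewrite -E1; ring.
    have -> : cos_primitive (i%:R + i%:R) (m%:R) =
        cos_primitive (i%:R + i%:R) (- m%:R) :> R.
      by apply/eqP; rewrite -subr_eq0 E2.
    by field.
  move=> j /negbTE ji; have := cos_primitive_period R i j m.
  have := cos_primitive_period R (i + j) 0 m.
  rewrite subr0 natrD addn_eq0 eqn0Ngt i0 /= eq_sym ji => E2 E1.
  rewrite sub0r opprK.
  rewrite -mulrBr opprD addrACA -mulrBr E1 E2 mulr0 addr0 mulr0 //.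
- by rewrite gtrN.
- by move=> x; apply: cvgM; exact: continuous_sine_psum.
Qed.

Definition sinc (R : realType) (t : R) : R := sin t / t.

Lemma one_minus_cos_le (R : realType) (t : R) : 0 < t -> `|1 - cos t| <= t.
Proof.
move=> t0; have [u _] := @MVT R cos (fun x => - sin x) 0 t t0
  (fun x _ => is_derive_cos x) (continuous_subspaceT (@continuous_cos R)).
rewrite cos0 subr0 => E; rewrite distrC E normrM normrN (gtr0_norm t0).
by rewrite -[leRHS]mul1r ler_wpM2r ?sin_max // ltW.
Qed.

Lemma one_minus_sinc_le (R : realType) (t : R) : 0 < t -> `|1 - sinc t| <= t.
Proof.
move=> t0; have [u] := @MVT R sin cos 0 t t0
  (fun x _ => is_derive_sin x) (continuous_subspaceT (@continuous_sin R)).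
rewrite in_itv /= => /andP[u0 ut]; rewrite sin0 !subr0 /sinc => ->.
rewrite mulfK ?gt_eqF //; apply: (le_trans (one_minus_cos_le u0)); exact: ltW.
Qed.

Lemma sinc_le1 (R : realType) (t : R) : 0 < t -> `|sinc t| <= 1.
Proof.
move=> t0; have [u _] := @MVT R sin cos 0 t t0
  (fun x _ => is_derive_sin x) (continuous_subspaceT (@continuous_sin R)).
rewrite sin0 !subr0 /sinc => ->.
by rewrite mulfK ?gt_eqF //; exact: cos_max.
Qed.

Lemma sinc_le_inv (R : realType) (t : R) : 0 < t -> `|sinc t| <= t^-1.
Proof.
move=> t0; rewrite /sinc normrM normfV (gtr0_norm t0) -[leRHS]mul1r.
by rewrite ler_wpM2r ?sin_max // invr_ge0 ltW.
Qed.

(** Averages over symmetric windows act diagonally on the sines, by the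
    multipliers [sinc]. *)
Lemma integral_sine_psum_window (R : realType) (a : nat -> R) (N : nat)
    (x h : R) : 0 < h ->
  (\int[lebesgue_measure]_(y in `[(x - h)%R, (x + h)%R])
     (sine_psum a N y)%:E)%E =
  (2 * h * sine_psum (fun j => a j * sinc (2 * pi * j%:R * h)) N x)%:E.
Proof.
move=> h0; pose F y := \sum_(1 <= j < N.+1)
  - (a j / (2 * pi * j%:R)) * cos (2 * pi * j%:R * y).
have Fd (y : R) : is_derive y 1 F (sine_psum a N y).
  apply: is_derive_bigsum => j.
  have -> : a j * sin (2 * pi * j%:R * y) = - (a j / (2 * pi * j%:R)) *
      (2 * pi * j%:R * - sin (2 * pi * j%:R * y)).
    have [->|j0] := eqVneq j 0%N; first by rewrite !(mulr0, mul0r) sin0 !mulr0.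
    have pi0 : pi != 0 :> R by rewrite gt_eqF ?pi_gt0.
    by move: (@pi R) pi0 => p p0; field; rewrite p0 pnatr_eq0 j0.
  by apply: is_derive_mull; exact: is_derive_mull_arg.
rewrite (integral_primitive _ _ Fd).
- congr (_%:E); rewrite /F /sine_psum -sumrB mulr_sumr.
  apply: eq_big_nat => j /andP[j0 _].
  have pi0 : pi != 0 :> R by rewrite gt_eqF ?pi_gt0.
  have jn0 : j%:R != 0 :> R by rewrite pnatr_eq0 -lt0n.
  have hn0 : h != 0 by rewrite gt_eqF.
  rewrite /sinc [_ * (x + h)]mulrDr [_ * (x - h)]mulrBr cosD cosB.
  by move: (@pi R) pi0 => p p0; field; rewrite jn0 hn0 p0.
- by lra.
- exact: continuous_sine_psum.
Qed.

Lemma sum_dilated_sine_psum (R : realType) (k : nat -> nat) (N J V : nat)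
    (b : nat -> nat -> R) (x : R) :
  (forall n, (0 < n)%N -> (0 < k n)%N) ->
  (forall n, (0 < n < N)%N -> (k n * J <= V)%N) ->
  (forall n j, (J < j)%N -> b n j = 0) ->
  \sum_(1 <= n < N) sine_psum (b n) J ((k n)%:R * x) =
  sine_psum (dilated_coef k N b) V x.
Proof.
move=> k0 kV bJ; rewrite /sine_psum /dilated_coef.
under [RHS]eq_bigr do rewrite mulr_suml.
rewrite [RHS](exchange_big_dep_nat xpredT) //=.
apply: eq_big_nat => n /andP[n0 nN].
pose G j := b n j * sin (2 * pi * j%:R * ((k n)%:R * x)).
transitivity (\sum_(1 <= v < V.+1 | (k n %| v)%N) G (v %/ k n)%N); last first.
  apply: eq_bigr => v kv; rewrite /G; congr (_ * sin _).
  by rewrite !mulrA -[_ * (v %/ _)%N%:R * _]mulrA -natrM divnK.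
rewrite sum_multiplesE ?k0 // (@big_cat_nat _ _ _ J.+1 _ (V %/ k n).+1) //=.
  rewrite [X in _ + X]big_nat_cond [X in _ + X]big1 ?addr0 // => j.
  by rewrite andbT => /andP[Jj _]; rewrite /G bJ // mul0r.
by rewrite ltnS leq_divRL ?k0 // mulnC kV // n0.
Qed.

Lemma integral_sum_dilated_sqr (R : realType) (k : nat -> nat) (N J V m : nat)
    (b : nat -> nat -> R) :
  (0 < m)%N -> (forall n, (0 < n)%N -> (0 < k n)%N) ->
  (forall n, (0 < n < N)%N -> (k n * J <= V)%N) ->
  (forall n j, (J < j)%N -> b n j = 0) ->
  (\int[lebesgue_measure]_(x in sym_itv R m)
     ((\sum_(1 <= n < N) sine_psum (b n) J ((k n)%:R * x)) ^+ 2)%:E)%E =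
  (m%:R * \sum_(1 <= v < V.+1) dilated_coef k N b v ^+ 2)%:E.
Proof.
move=> m0 k0 kV bJ; rewrite -integral_sine_psum_sqr //.
by apply: eq_integral => x _; rewrite (sum_dilated_sine_psum x k0 kV bJ).
Qed.

(** * Exceptional sets of small measure *)

Lemma measurable_sym_itv (R : realType) (m : nat) : measurable (sym_itv R m).
Proof. exact: measurable_itv. Qed.

Lemma integrable_sym_itv (R : realType) (g : R -> R) (m : nat) :
  continuous g -> lebesgue_measure.-integrable (sym_itv R m) (EFin \o g).
Proof.
move=> gc; apply: continuous_compact_integrable; first exact: segment_compact.
exact: continuous_subspaceT.
Qed.

Lemma measurable_superlevel (R : realType) (g : R -> R) (m : nat) (c : R) :
  continuous g -> measurable (sym_itv R m `&` [set x | c <= g x]).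
Proof.
move=> gc; apply: measurableI; first exact: measurable_sym_itv.
rewrite (_ : [set x | _] = g @^-1` `[c, +oo[%classic); last first.
  by apply/seteqP; split => x /=; rewrite in_itv /= andbT.
rewrite -[X in measurable X]setTI.
exact: continuous_measurable_fun.
Qed.

Lemma markov_sym_itv (R : realType) (g : R -> R) (m : nat) (c I : R) :
  continuous g -> (forall x, 0 <= g x) -> 0 < c ->
  (\int[lebesgue_measure]_(x in sym_itv R m) (g x)%:E <= I%:E)%E ->
  (lebesgue_measure (sym_itv R m `&` [set x | (c <= g x)%R]) <= (I / c)%:E)%E.
Proof.
move=> gc g0 c0 gI.
have mg : measurable_fun (sym_itv R m) (EFin \o g).
  exact: (measurable_int lebesgue_measure (integrable_sym_itv m gc)).
have h := @le_integral_comp_abse _ _ R lebesgue_measure _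
  (measurable_sym_itv m) (EFin \o g) c id (@measurable_id _ _ _)
  (fun r h => h) (fun x y _ _ h => h) mg c0.
rewrite EFinM muleC lee_pdivlMl //.
apply: le_trans gI; rewrite (_ : [set x | (c <= g x)%R] =
    [set x | (c%:E <= `|(EFin \o g) x|)%E]); last first.
  by apply/seteqP; split => x /=; rewrite lee_fin ger0_norm.
apply: le_trans h _; rewrite le_eqVlt; apply/orP; left; apply/eqP.
by apply: eq_integral => x _ /=; rewrite ger0_norm.
Qed.

(** The Hardy-Littlewood maximal inequality for [H] restricted to
    [[-m-1, m+1]]: windows of half-length at most 1 centred in [[-m, m]] do
    not see the restriction. *)
Lemma window_average_exceptional_set (R : realType) (H : R -> R) (m : nat)
    (c : R) :
  continuous H -> 0 < c ->
  exists B : set R, [/\ measurable B,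
    (lebesgue_measure B <=
     (3 / c)%:E * \int[lebesgue_measure]_(x in sym_itv R m.+1) `|H x|%:E)%E
  & forall x h, sym_itv R m x -> ~ B x -> 0 < h -> h <= 1 ->
     (`|\int[lebesgue_measure]_(y in `[(x - h)%R, (x + h)%R]) (H y)%:E|
        <= (2 * h * c)%:E)%E].
Proof.
move=> Hc c0; set D := sym_itv R m.+1.
have mD : measurable D by exact: measurable_sym_itv.
have Hi := integrable_sym_itv m.+1 Hc.
have lH := integrable_locally_restrict mD Hi.
exists [set x | (c%:E < HL_maximal (H \_ D) x)%E]; split.
- rewrite -[X in measurable X]setTI; apply: emeasurable_fun_o_infty => //.
  exact: measurable_HL_maximal.
- apply: le_trans (maximal_inequality lH c0) _.
  apply: lee_wpmul2l; first by rewrite lee_fin divr_ge0 // ltW.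
  rewrite [leRHS]integral_mkcond le_eqVlt; apply/orP; left; apply/eqP.
  apply: eq_integral => x _ /=; rewrite /patch; case: ifP => //.
  by rewrite normr0.
move=> x h; rewrite /sym_itv /= in_itv /= => /andP[mx xm] /negP.
rewrite -leNgt => HLx h0 h1.
have sub : `[x - h, x + h]%classic `<=` D.
  move=> y; rewrite /D /sym_itv /= !in_itv /= -natr1 => /andP[y1 y2].
  by apply/andP; split; lra.
have avg : (iavg (H \_ D) (ball x h) <= c%:E)%E.
  apply: le_trans HLx; apply: ereal_sup_ubound; exists h => //=.
  by rewrite in_itv /= h0.
have mI : measurable `[x - h, x + h]%classic by exact: measurable_itv.
have HI : lebesgue_measure.-integrable `[x - h, x + h] (EFin \o H).
  exact: integrableS Hi.
apply: le_trans (le_abse_integral _ _ _) _ => //.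
  exact: (measurable_int lebesgue_measure HI).
have E : (\int[lebesgue_measure]_(y in `[(x - h)%R, (x + h)%R]) `|(H y)%:E| =
    \int[lebesgue_measure]_(y in ball x h) `|((H \_ D) y)%:E|)%E.
  rewrite ball_itv integral_itv_bndoo.
    apply: eq_integral => y; rewrite inE => yI; rewrite patchE mem_set //.
    by apply: sub; exact: subset_itv_oo_cc yI.
  apply: measurable_funS (measurable_int lebesgue_measure (integrable_abse HI)).
    exact: measurable_itv.
  exact: subset_itv_oo_cc.
rewrite E; move: avg; rewrite /iavg lebesgue_measure_ball ?(ltW h0) //.
rewrite inver mulrn_eq0 /= (gt_eqF h0) /=.
rewrite lee_pdivrMl ?mulrn_wgt0 //.
by rewrite -[h *+ 2]mulr_natl -EFinM.
Qed.

(** * From maximal inequalities to almost everywhere convergence *)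

Lemma inv_succ_le (R : realType) (d : R) :
  0 < d -> exists i : nat, (i.+1%:R)^-1 <= d.
Proof.
move=> d0; exists (Num.truncn d^-1).
by rewrite -[leRHS]invrK lef_pV2 ?posrE ?invr_gt0 ?ltr0n // ltW // truncnS_gt.
Qed.

Lemma cvgn_of_tail_bound (R : realType) (u : nat -> R) :
  (forall e, 0 < e -> exists M0, forall M, (M0 <= M)%N ->
     `|u M - u M0| <= e) ->
  cvgn u.
Proof.
move=> H; apply/cauchy_cvgP/cauchyP => e e0.
have e2 : 0 < e / 2 by rewrite divr_gt0.
have [M0 hM0] := H _ e2; exists (u M0); exists M0 => // M /= M0M.
rewrite /ball /= distrC; apply: le_lt_trans (hM0 _ M0M) _.
by rewrite ltr_pdivrMr // ltr_pMr // ltr1n.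
Qed.


(** The set [B] may depend on [M1]. It only serves to bound the measure of the
    set where some [S M] with [M0 <= M <= M1] is far from [S M0]; this set
    increases with [M1], so that its union over [M1] satisfies the same bound.
    Intersecting over [d] gives a null set for each [e]. *)
Lemma ae_cvgn_of_maximal_bound (R : realType) (S : nat -> R -> R) (m : nat) :
  (forall M, continuous (S M)) ->
  (forall e d : R, 0 < e -> 0 < d -> exists M0, forall M1,
     exists B : set R, [/\ measurable B, (lebesgue_measure B <= d%:E)%E
       & forall x M, sym_itv R m x -> ~ B x -> (M0 <= M <= M1)%N ->
           `|S M x - S M0 x| <= e]) ->
  {ae lebesgue_measure, forall x : R, sym_itv R m x -> cvgn (S^~ x)}.
Proof.
move=> Sc HS.
pose A (e : R) (M0 M1 : nat) : set R :=
  \bigcup_(M in [set M | (M0 <= M <= M1)%N])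
    (sym_itv R m `&` [set x | e < `|S M x - S M0 x|]).
have mA e M0 M1 : measurable (A e M0 M1).
  apply: bigcup_measurable => M _; apply: measurableI.
    exact: measurable_sym_itv.
  rewrite -[X in measurable X]setTI.
  apply: (@measurable_fun_ltr _ _ R setT (cst e)
     (fun x => `|S M x - S M0 x|)) => //.
  apply: measurableT_comp => //; apply: measurable_funB;
    exact: continuous_measurable_fun.
have Aub e d : 0 < e -> 0 < d ->
    exists M0, (lebesgue_measure (\bigcup_M1 A e M0 M1) <= d%:E)%E.
  move=> e0 d0; have [M0 hM0] := HS e d e0 d0; exists M0.
  have cA := @nondecreasing_cvg_mu _ _ R lebesgue_measure (A e M0) (mA e M0)
     (bigcupT_measurable _ (mA e M0)) _.
  have And : {homo A e M0 : n m / (n <= m)%N >-> (n <= m)%O}.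
    move=> i j ij; apply/subsetPset => x [M /= /andP[M0M Mi] h].
    by exists M => //=; rewrite M0M (leq_trans Mi).
  have {}cA := cA And.
  rewrite -(cvg_lim _ cA) //; apply: lime_le.
    by apply/cvg_ex; eexists; exact: cA.
  near=> M1; have [B [mB mBd hB]] := hM0 M1.
  apply: le_trans mBd; apply: le_measure; rewrite ?inE //; first exact: mA.
  move=> x [M /= hM [Dx /= hx]]; apply: contrapT => Bx.
  by move: hx; apply/negP; rewrite -leNgt; exact: (hB x M).
have eps0 (j : nat) : 0 < (j.+1%:R : R)^-1 by rewrite invr_gt0 ltr0n.
pose M0 j i := projT1 (cid (Aub _ _ (eps0 j) (eps0 i))).
pose N := \bigcup_j \bigcap_i \bigcup_M1 A (j.+1%:R)^-1 (M0 j i) M1.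
have N0 : lebesgue_measure.-negligible N.
  apply: negligible_bigcup => j.
  exists (\bigcap_i \bigcup_M1 A (j.+1%:R)^-1 (M0 j i) M1).
  have mi i : measurable (\bigcup_M1 A (j.+1%:R)^-1 (M0 j i) M1).
    exact: bigcupT_measurable.
  have mI : measurable (\bigcap_i \bigcup_M1 A (j.+1%:R)^-1 (M0 j i) M1).
    exact: bigcapT_measurable.
  split => //; apply/eqP; rewrite eq_le measure_ge0 andbT.
  apply/lee_addgt0Pr => d d0; rewrite add0e.
  have [i hi] := inv_succ_le d0.
  apply: le_trans (_ : ((i.+1%:R : R)^-1)%:E <= d%:E)%E; last by rewrite lee_fin.
  apply: le_trans (projT2 (cid (Aub _ _ (eps0 j) (eps0 i)))).
  apply: le_measure; [by rewrite inE|by rewrite inE; exact: mi|].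
  by move=> x /(_ i I).
apply: negligibleS N0 => x /=.
move=> /not_implyP [Dx ncv].
apply: contrapT => nN; apply: ncv.
apply: cvgn_of_tail_bound => e e0.
have [j hj] := inv_succ_le e0.
have : ~ (\bigcap_i \bigcup_M1 A (j.+1%:R)^-1 (M0 j i) M1) x.
  by move=> h; apply: nN; exists j.
move=> /existsNP [i] /not_implyP [_ hi].
exists (M0 j i) => M M0M; apply: le_trans hj; rewrite leNgt; apply/negP => h.
apply: hi; exists M => //; exists M => //=.
by rewrite M0M leqnn.
Unshelve. all: by end_near. Qed.

(** * Dilations of periodic functions *)

Definition affine (R : realType) (c t : R) (x : measurableTypeR R) :
  measurableTypeR R := c * x + t.

Lemma measurable_affine (R : realType) (c t : R) :
  measurable_fun setT (affine c t).
Proof.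
apply: (@measurable_funD _ _ R setT (fun x => c * x) (cst t)) => //.
exact: mulrl_measurable.
Qed.

Definition affine_image_measure (R : realType) (c t : R) :
  {measure set (measurableTypeR R) -> \bar R}.
Proof.
refine (pushforward lebesgue_measure (affine c t)).
exact: measurable_affine.
Defined.

Lemma affine_preimage_itv (R : realType) (c t a b : R) : 0 < c ->
  affine c t @^-1` `](c * a + t), (c * b + t)] = `]a, b]%classic.
Proof.
move=> c0; apply/seteqP; split => x /=;
  by rewrite /affine !in_itv /= ltrD2r lerD2r ltr_pM2l // ler_pM2l.
Qed.

(** Both sides are measures, and they agree on half-open intervals. *)
Lemma lebesgue_measure_affine (R : realType) (c t : R) (A : set R) :
  0 < c -> measurable A ->
  (lebesgue_measure A = c%:E * lebesgue_measure (affine c t @^-1` A))%E.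
Proof.
move=> c0 mA; pose cn := NngNum (ltW c0).
transitivity (mscale cn (affine_image_measure c t) A) => //.
apply: lebesgue_measure_unique => // _ [[a b] _ <-] /=.
rewrite /mscale /= /affine_image_measure /pushforward /=.
have E x : x = c * ((x - t) / c) + t by rewrite mulrC divfK ?subrK // gt_eqF.
have -> : affine c t @^-1` `]a, b] = `]((a - t) / c), ((b - t) / c)]%classic.
  by have := affine_preimage_itv t ((a - t) / c) ((b - t) / c) c0; rewrite -!E.
rewrite !lebesgue_measure_itv /= !lte_fin ltr_pM2r ?invr_gt0 // ltrD2r.
case: ifP => _; last by rewrite mule0.
by rewrite -!EFinB -EFinM; congr (_%:E); field; rewrite gt_eqF.
Qed.

Lemma integral_affine (R : realType) (g : R -> R) (c t a b : R) :
  0 < c -> measurable_fun setT g -> (forall x, 0 <= g x) ->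
  (\int[lebesgue_measure]_(x in `]a, b]) (g (c * x + t)%R)%:E =
   (c^-1)%:E * \int[lebesgue_measure]_(y in `](c * a + t)%R, (c * b + t)%R])
      (g y)%:E)%E.
Proof.
move=> c0 mg g0; pose cn := NngNum (ltW c0).
set D := `](c * a + t)%R, (c * b + t)%R]%classic.
have mD : measurable D by exact: measurable_itv.
have mgD : measurable_fun D (EFin \o g).
  by apply/measurable_EFinP; exact: measurable_funTS.
have -> : (\int[lebesgue_measure]_(y in D) (g y)%:E =
   \int[mscale cn (affine_image_measure c t)]_(y in D)
     (g y)%:E)%E.
  apply: eq_measure_integral => A mA _.
  exact: lebesgue_measure_affine.
rewrite ge0_integral_mscale //=; last by move=> x _; rewrite lee_fin.
have D0 : {in D, forall y : R, (0 <= (g y)%:E)%E}.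
  by move=> y _; rewrite lee_fin.
have := ge0_integral_pushforward (measurable_affine c t) lebesgue_measure
  mD mgD D0; rewrite affine_preimage_itv // => ->.
by rewrite muleA -EFinM mulVf ?gt_eqF // mul1e.
Qed.

Lemma periodicD_nat (R : realType) (g : R -> R) (n : nat) (x : R) :
  (forall x, g (x + 1) = g x) -> g (x + n%:R) = g x.
Proof.
move=> gp; elim: n => [|n IH]; first by rewrite addr0.
by rewrite -natr1 addrA gp.
Qed.

Lemma integral_periodic_unit (R : realType) (g : R -> R) (z : nat) (s : bool) :
  measurable_fun setT g -> (forall x, 0 <= g x) -> (forall x, g (x + 1) = g x) ->
  let t : R := if s then z%:R else - z%:R in
  (\int[lebesgue_measure]_(x in `]t, (t + 1)%R]) (g x)%:E =
   \int[lebesgue_measure]_(x in `]0%R, 1%R]) (g x)%:E)%E.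
Proof.
move=> mg g0 gp t; have := @integral_affine R g 1 t 0 1 ltr01 mg g0.
rewrite invr1 mul1e mulr0 mulr1 add0r addrC => <-.
apply: eq_integral => x _; rewrite mul1r /t; case: s {t}; congr (_%:E).
  by rewrite periodicD_nat.
by rewrite -[in RHS](subrK z%:R x) periodicD_nat.
Qed.

Lemma integral_periodic (R : realType) (g : R -> R) (n : nat) :
  measurable_fun setT g -> (forall x, 0 <= g x) -> (forall x, g (x + 1) = g x) ->
  (\int[lebesgue_measure]_(x in `](- n%:R)%R, n%:R]) (g x)%:E =
   (2 * n%:R)%:E * \int[lebesgue_measure]_(x in `]0%R, 1%R]) (g x)%:E)%E.
Proof.
move=> mg g0 gp; have mgA (A : set R) : measurable_fun A (EFin \o g).
  by apply/measurable_EFinP; exact: measurable_funTS.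
elim: n => [|n IH].
  by rewrite oppr0 set_itv_ge ?bnd_simp ?ltxx // integral_set0 mulr0 mul0e.
have I0 : (0 <= \int[lebesgue_measure]_(x in `]0%R, 1%R]) (g x)%:E)%E.
  by apply: integral_ge0 => x _; rewrite lee_fin.
have splitI (a b c : R) : a <= b -> b <= c ->
   (\int[lebesgue_measure]_(x in `]a, c]) (g x)%:E =
    \int[lebesgue_measure]_(x in `]a, b]) (g x)%:E +
    \int[lebesgue_measure]_(x in `]b, c]) (g x)%:E)%E.
  move=> ab bc; rewrite (@itv_bndbnd_setU _ _ _ (BRight b)) ?bnd_simp //.
  rewrite ge0_integral_setU //=.
  - exact: mgA.
  - by move=> x _; rewrite lee_fin.
  - apply/disj_setPS => x /= []; rewrite !in_itv /= => /andP[_ xb] /andP[bx _].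
    by move: xb; rewrite leNgt bx.
have e1 : - n.+1%:R + 1 = - n%:R :> R by rewrite -natr1 opprD addrNK.
have n0 := ler0n R n; have nS : n%:R <= n.+1%:R :> R by rewrite ler_nat.
rewrite (splitI (- n.+1%:R) (- n%:R) n.+1%:R); [|lra|lra].
rewrite (splitI (- n%:R) n%:R n.+1%:R); [|lra|lra].
have := @integral_periodic_unit _ g n.+1 false mg g0 gp; rewrite /= e1 => ->.
have := @integral_periodic_unit _ g n true mg g0 gp; rewrite /= natr1 => ->.
set I := (\int[_]_(x in _) _)%E in IH I0 *.
have -> : 2 * n.+1%:R = 1 + (2 * n%:R + 1) :> R by rewrite -[n.+1%:R]natr1; ring.
rewrite IH EFinD ge0_muleDl ?lee_fin ?addr_ge0 ?mulr_ge0 //.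
by rewrite EFinD ge0_muleDl ?lee_fin ?mulr_ge0 // mul1e.
Qed.

(** The dilation by [k] carries [[-m, m]] onto [2 * k * m] periods. *)
Lemma integral_dilated_periodic (R : realType) (g : R -> R) (m k : nat) :
  (0 < k)%N ->
  measurable_fun setT g -> (forall x, 0 <= g x) -> (forall x, g (x + 1) = g x) ->
  (\int[lebesgue_measure]_(x in sym_itv R m) (g (k%:R * x)%R)%:E =
   (2 * m%:R)%:E * \int[lebesgue_measure]_(x in `[0%R, 1%R]) (g x)%:E)%E.
Proof.
move=> k0 mg g0 gp; have k0R : 0 < k%:R :> R by rewrite ltr0n.
have mgA (A : set R) : measurable_fun A (EFin \o g).
  by apply/measurable_EFinP; exact: measurable_funTS.
have mgk (A : set R) : measurable_fun A (fun x => (g (k%:R * x))%:E).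
  apply/measurable_EFinP; apply: measurable_funTS.
  exact: measurableT_comp (mulrl_measurable _).
rewrite /sym_itv -integral_itv_obnd_cbnd; last exact: mgk.
rewrite -integral_itv_obnd_cbnd; last exact: mgA.
have := @integral_affine R g k%:R 0 (- m%:R) m%:R k0R mg g0.
under eq_integral do rewrite addr0.
rewrite !addr0 mulrN -natrM => ->.
rewrite integral_periodic // muleA -EFinM natrM.
by congr ((_%:E) * _)%E; field; rewrite gt_eqF.
Qed.

(** * The weight of the coefficients and the multipliers of the windows *)

Lemma geometric_sum_le (R : realType) (r : R) (n : nat) :
  0 <= r -> r < 1 -> \sum_(0 <= i < n) r ^+ i <= (1 - r)^-1.
Proof.
move=> r0 r1; have r10 : 0 < 1 - r by rewrite subr_gt0.
rewrite -[leRHS]mul1r ler_pdivlMr // mulrC.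
have -> : (1 - r) * \sum_(0 <= i < n) r ^+ i = 1 - r ^+ n.
  elim: n => [|n IH]; first by rewrite big_geq // mulr0 subrr.
  by rewrite big_nat_recr //= mulrDr IH exprS; ring.
by rewrite gerBl exprn_ge0.
Qed.

Definition pow_weight (R : realType) (s : R) (d : nat) : R :=
  d%:R `^ (1 - 2 * s).

Lemma pow_weightM (R : realType) (s : R) (d e : nat) :
  pow_weight s (d * e) = pow_weight s d * pow_weight s e.
Proof. by rewrite /pow_weight natrM powRM. Qed.

Lemma pow_weightX (R : realType) (s : R) (d p : nat) :
  pow_weight s (d ^ p) = pow_weight s d ^+ p.
Proof.
elim: p => [|p IH]; first by rewrite expn0 expr0 /pow_weight powR1.
by rewrite expnS pow_weightM IH exprS.
Qed.

Lemma pow_weight_nonincreasing (R : realType) (s : R) (d e : nat) :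
  1 / 2 < s -> (0 < d)%N -> (d <= e)%N -> pow_weight s e <= pow_weight s d.
Proof.
move=> s2 d0 de; have e0 : (0 < e)%N := leq_trans d0 de.
rewrite /pow_weight (_ : 1 - 2 * s = - (2 * s - 1)); last by ring.
rewrite !powRN lef_pV2 ?posrE ?powR_gt0 ?ltr0n //.
by apply: ge0_ler_powR; rewrite ?nnegrE ?ler0n ?ler_nat //; lra.
Qed.

Lemma pow_weight2_lt1 (R : realType) (s : R) : 1 / 2 < s -> pow_weight s 2 < 1.
Proof.
move=> s2; rewrite /pow_weight (_ : 1 - 2 * s = - (2 * s - 1)); last by ring.
rewrite powRN invf_lt1 ?powR_gt0 //.
have h : 0 < 2 * s - 1 by lra.
by have := @gt0_ltr_powR R _ h 1 2; rewrite !nnegrE powR1 => -> //; rewrite ltr1n.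
Qed.

(** The block [[2^p, 2^(p+1))] contributes at most
    [pow_weight s (2^p) = pow_weight s 2 ^+ p], and this is geometric. *)
Lemma pow_weight_tail (R : realType) (s : R) (P E : nat) :
  1 / 2 < s ->
  \sum_(2 ^ P <= j < E) pow_weight s j / j%:R <=
  pow_weight s 2 ^+ P * (1 - pow_weight s 2)^-1.
Proof.
move=> s2; set rho := pow_weight s 2.
have rho0 : 0 <= rho by exact: powR_ge0.
have rho1 : rho < 1 by exact: pow_weight2_lt1.
have f0 j : 0 <= pow_weight s j / j%:R by rewrite divr_ge0 ?powR_ge0.
have dyadic p : \sum_(2 ^ p <= j < 2 ^ p.+1) pow_weight s j / j%:R <= rho ^+ p.
  apply: (@le_trans _ _ (\sum_(2 ^ p <= j < 2 ^ p.+1) rho ^+ p / (2 ^ p)%:R)).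
    apply: ler_sum_nat => j /andP[pj _].
    have p0 : (0 < 2 ^ p)%N by rewrite expn_gt0.
    rewrite ler_pM ?powR_ge0 ?invr_ge0 //.
      by rewrite -pow_weightX; exact: pow_weight_nonincreasing.
    by rewrite lef_pV2 ?posrE ?ltr0n ?ler_nat // (leq_trans p0).
  rewrite sumr_const_nat expnS mul2n -addnn addnK -[leLHS]mulr_natr divfK //.
have blocks T : \sum_(2 ^ P <= j < 2 ^ (P + T)) pow_weight s j / j%:R <=
    rho ^+ P * \sum_(0 <= i < T) rho ^+ i.
  elim: T => [|T IH]; first by rewrite addn0 !big_geq // mulr0.
  rewrite addnS (@big_cat_nat _ _ _ (2 ^ (P + T))) ?leq_exp2l ?leq_addr //=.
  by rewrite big_nat_recr //= mulrDr lerD // -exprD.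
have hE : (E <= 2 ^ (P + E))%N.
  by rewrite (leq_trans (ltnW (ltn_expl E (ltnSn 1)))) // leq_exp2l ?leq_addl.
apply: (@le_trans _ _ (\sum_(2 ^ P <= j < 2 ^ (P + E)) pow_weight s j / j%:R)).
  have [PE|EP] := leqP (2 ^ P)%N E; last by rewrite big_geq ?sumr_ge0 // ltnW.
  by rewrite [leRHS](@big_cat_nat _ _ _ E) //= lerDl sumr_ge0.
apply: le_trans (blocks E) _; rewrite ler_wpM2l ?exprn_ge0 //.
exact: geometric_sum_le.
Qed.

Lemma pow_weight_mult_weight (R : realType) (s : R) :
  1 / 2 < s -> mult_weight (pow_weight s) (1 - pow_weight s 2)^-1.
Proof.
move=> s2; split; [by move=> d; exact: powR_ge0|exact: pow_weightM|].
by move=> E; have := pow_weight_tail 0 E s2; rewrite expn0 expr0 mul1r.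
Qed.

Lemma exp_le_quarter (R : realType) (r : R) :
  0 <= r -> r < 1 -> exists C : nat, r ^+ C <= 4^-1.
Proof.
move=> r0 r1; have : (r ^+ n @[n --> \oo] --> (0 : R)).
  by apply: cvg_expr; rewrite ger0_norm.
move=> /cvgrPdist_le /(_ 4^-1 ltac:(by rewrite invr_gt0)) [C _ /(_ C)] /=.
by rewrite sub0r normrN ger0_norm ?exprn_ge0 // => /(_ (leqnn _)); exists C.
Qed.

(** The finitely many indices at which the asymptotic bound may fail are
    absorbed by the constant. *)
Lemma bigO_coef_sqr_le (R : realType) (s : R) (a : nat -> R) :
  a =O_\oo (fun j : nat => j%:R `^ (- s)) ->
  exists A : R, 0 <= A /\ forall j, (0 < j)%N ->
    a j ^+ 2 <= A * (pow_weight s j / j%:R).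
Proof.
move=> /eqO_exP [K K0 [N _ hN]].
pose A := K ^+ 2 + \sum_(0 <= j < N) a j ^+ 2 / (pow_weight s j / j%:R).
have f0 j : (0 < j)%N -> 0 < pow_weight s j / j%:R.
  by move=> j0; rewrite divr_gt0 ?powR_gt0 ?ltr0n.
have g0 j : 0 <= a j ^+ 2 / (pow_weight s j / j%:R).
  by rewrite divr_ge0 ?sqr_ge0 // divr_ge0 ?powR_ge0.
exists A; split; first by rewrite addr_ge0 ?sqr_ge0 ?sumr_ge0.
move=> j j0; have [jN|Nj] := ltnP j N.
  rewrite -ler_pdivrMr ?f0 // /A.
  rewrite (bigD1_seq j) ?mem_index_iota ?iota_uniq //= addrCA lerDl.
  by rewrite addr_ge0 ?sqr_ge0 ?sumr_ge0.
have := hN j Nj; rewrite /= (ger0_norm (powR_ge0 _ _)) => aj.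
have jn0 : (j%:R != 0 :> R) by rewrite pnatr_eq0 -lt0n.
have -> : pow_weight s j / j%:R = (j%:R `^ (- s)) ^+ 2.
  rewrite /pow_weight -[X in _ / X](powRr1 (ler0n R j)) -powRN -powRD.
    by rewrite expr2 -powRD ?jn0 ?implybT //; congr (_ `^ _); ring.
  by rewrite jn0 implybT.
rewrite -[a j ^+ 2]real_normK ?num_real //.
apply: (@le_trans _ _ ((K * j%:R `^ (- s)) ^+ 2)).
  by rewrite ler_pXn2r ?nnegrE ?mulr_ge0 ?powR_ge0 // ltW.
rewrite exprMn ler_wpM2r ?sqr_ge0 // /A lerDl sumr_ge0 //.
Qed.

(** Let [2^q <= k < 2^(q+1)]. For [Q <= q] the square is at most [4^(Q-q)], by
    [sinc_le_inv]; for [Q > q + L] it decays like [4^(q+L-Q)], by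
    [one_minus_sinc_le]; each of the [L] terms in between is at most 4. *)
Lemma sum_window_multiplier_le (R : realType) (k j L B : nat) :
  (0 < k)%N -> (0 < j < 2 ^ L)%N ->
  \sum_(0 <= Q < B)
    ((k < 2 ^ Q)%N%:R - sinc (2 * pi * (k * j)%N%:R * (2 ^ Q)%N%:R^-1)) ^+ 2
  <= 130 * L.+1%:R :> R.
Proof.
move=> k0 /andP[j0 jL]; have kj0 : (0 < k * j)%N by rewrite muln_gt0 k0.
pose x Q : R := 2 * pi * (k * j)%N%:R * (2 ^ Q)%N%:R^-1.
pose F Q : R := ((k < 2 ^ Q)%N%:R - sinc (x Q)) ^+ 2.
have F0 Q : 0 <= F Q by exact: sqr_ge0.
have x0 Q : 0 < x Q.
  by rewrite /x !mulr_gt0 ?pi_gt0 ?ltr0n ?invr_gt0 ?ltr0n ?expn_gt0.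
have half0 : 0 <= 2^-1 :> R by rewrite invr_ge0.
have half n : \sum_(0 <= i < n) (2^-1 : R) ^+ i <= 2.
  have h1 : 2^-1 < 1 :> R by lra.
  apply: le_trans (geometric_sum_le n half0 h1) _.
  by rewrite (_ : 1 - 2^-1 = 2^-1) ?invrK //; lra.
have half2 i : ((2^-1 : R) ^+ i) ^+ 2 <= 2^-1 ^+ i.
  rewrite expr2 -[leRHS]mulr1 ler_wpM2l ?exprn_ge0 //.
  by rewrite exprn_ile1 //; lra.
have := @trunc_log_bounds 2 k isT k0; set q := trunc_log 2 k => /= /andP[qk kq].
have e2 i : (2 ^ i)%N%:R = (2 : R) ^+ i by rewrite natrX.
have low : \sum_(0 <= Q < q.+1) F Q <= 2.
  rewrite big_nat_rev /= add0n; apply: le_trans (half q.+1).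
  apply: ler_sum_nat => i /andP[_ iq]; rewrite subSS.
  apply: le_trans (half2 i); rewrite /F ltnNge.
  have iq' : (2 ^ (q - i) <= k)%N.
    by apply: leq_trans qk; rewrite leq_exp2l // leq_subr.
  rewrite iq' /= sub0r sqrrN -[leLHS]real_normK ?num_real //.
  rewrite ler_pXn2r ?nnegrE ?exprn_ge0 //.
  apply: le_trans (sinc_le_inv (x0 _)) _.
  rewrite -[leRHS]invrK lef_pV2 ?posrE ?x0 ?invr_gt0 ?exprn_gt0 ?invr_gt0 //.
  rewrite -exprVn invrK /x e2 ler_pdivlMr ?exprn_gt0 // -exprD subnKC // -e2.
  apply: (@le_trans _ _ (k * j)%N%:R).
    by rewrite ler_nat (leq_trans qk) // leq_pmulr.
  by rewrite ler_peMl ?ler0n //; have := pi_ge2 R; lra.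
have mid : \sum_(q.+1 <= Q < q.+1 + L) F Q <= 4 * L%:R.
  apply: (@le_trans _ _ (\sum_(q.+1 <= Q < q.+1 + L) 4)).
    apply: ler_sum_nat => Q _; rewrite /F -[leLHS]real_normK ?num_real //.
    rewrite (_ : 4 = 2 ^+ 2); last by ring.
    rewrite ler_pXn2r ?nnegrE //; apply: le_trans (ler_normB _ _) _.
    have := sinc_le1 (x0 Q); have : `|(k < 2 ^ Q)%N%:R| <= 1 :> R.
      by case: (k < _)%N; rewrite ?normr1 ?normr0.
    by lra.
  by rewrite sumr_const_nat addKn mulr_natr.
have high : \sum_(q.+1 + L <= Q < q.+1 + L + B) F Q <= 128.
  rewrite -{1}[(q.+1 + L)%N]add0n big_addn addKn.
  apply: (@le_trans _ _ (64 * \sum_(0 <= i < B) (2^-1 : R) ^+ i)); last first.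
    by rewrite (_ : 128 = 64 * 2); [rewrite ler_wpM2l|ring].
  rewrite mulr_sumr; apply: ler_sum_nat => i _.
  have kQ : (k < 2 ^ (i + (q.+1 + L)))%N.
    by apply: (leq_trans kq); rewrite leq_exp2l //; lia.
  apply: (@le_trans _ _ (64 * ((2^-1 : R) ^+ i) ^+ 2)); last by rewrite ler_wpM2l.
  rewrite /F kQ -[leLHS]real_normK ?num_real //.
  rewrite (_ : 64 * _ ^+ 2 = (8 * 2^-1 ^+ i) ^+ 2); last by ring.
  rewrite ler_pXn2r ?nnegrE ?mulr_ge0 ?exprn_ge0 //.
  apply: le_trans (one_minus_sinc_le (x0 _)) _.
  rewrite /x ler_pdivrMr ?ltr0n ?expn_gt0 // e2 exprD.
  have -> : 8 * 2^-1 ^+ i * (2 ^+ i * 2 ^+ (q.+1 + L)) = 8 * 2 ^+ (q.+1 + L) :> R.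
    rewrite mulrA -[8 * _ * _]mulrA -exprMn mulVf ?expr1n ?mulr1 //.
  rewrite -e2; apply: ler_pM; rewrite ?mulr_ge0 ?pi_ge0 //.
    by have := pihalf_lt2 R; lra.
  by rewrite ler_nat expnD leq_mul // ltnW.
apply: (@le_trans _ _ (\sum_(0 <= Q < q.+1 + L + B) F Q)).
  by rewrite [leRHS](@big_cat_nat _ _ _ B) ?leq_addl //= lerDl sumr_ge0.
rewrite (@big_cat_nat _ _ _ (q.+1 + L)) ?leq_addr //=.
rewrite (@big_cat_nat _ _ _ q.+1) ?leq_addr //=.
apply: le_trans (lerD (lerD low mid) high) _.
rewrite -[L.+1%:R]natr1; have := ler0n R L; lra.
Qed.

(** * Integrals over symmetric intervals *)

Definition sym_int (R : realType) (m : nat) (g : R -> R) : R :=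
  \int[lebesgue_measure]_(x in sym_itv R m) g x.

Lemma sym_intE (R : realType) (m : nat) (g : R -> R) : continuous g ->
  (\int[lebesgue_measure]_(x in sym_itv R m) (g x)%:E = (sym_int m g)%:E)%E.
Proof.
move=> gc; rewrite /sym_int /Rintegral fineK //.
apply: integrable_fin_num; first exact: measurable_sym_itv.
exact: integrable_sym_itv.
Qed.

Lemma sym_int_sum (R : realType) (m : nat) (I : Type) (s : seq I) (P : pred I)
    (F : I -> R -> R) : (forall i, continuous (F i)) ->
  sym_int m (fun x => \sum_(i <- s | P i) F i x) =
  \sum_(i <- s | P i) sym_int m (F i).
Proof.
move=> Fc; elim: s => [|i s IH].
  rewrite big_nil /sym_int /Rintegral integral0_eq // => x _.
  by rewrite big_nil.
rewrite big_cons -IH; case: ifPn => Pi.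
  rewrite -RintegralD; last 3 first.
  - exact: measurable_sym_itv.
  - exact: integrable_sym_itv.
  - by apply: integrable_sym_itv; exact: continuous_bigsum.
  by apply: eq_Rintegral => x _; rewrite big_cons Pi.
by apply: eq_Rintegral => x _; rewrite big_cons (negbTE Pi).
Qed.

Lemma sym_intZ (R : realType) (m : nat) (c : R) (g : R -> R) : continuous g ->
  sym_int m (fun x => c * g x) = c * sym_int m g.
Proof.
move=> gc; apply: RintegralZl; first exact: measurable_sym_itv.
exact: integrable_sym_itv.
Qed.

Lemma sym_intD (R : realType) (m : nat) (f g : R -> R) :
  continuous f -> continuous g ->
  sym_int m (fun x => f x + g x) = sym_int m f + sym_int m g.
Proof.
move=> fc gc; apply: RintegralD; first exact: measurable_sym_itv.
- exact: integrable_sym_itv.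
- exact: integrable_sym_itv.
Qed.

Lemma le_sym_int (R : realType) (m : nat) (f g : R -> R) :
  continuous f -> continuous g -> (forall x, f x <= g x) ->
  sym_int m f <= sym_int m g.
Proof.
move=> fc gc fg; apply: le_Rintegral => //; first exact: measurable_sym_itv.
- exact: integrable_sym_itv.
- exact: integrable_sym_itv.
Qed.

Lemma sym_int_cst (R : realType) (m : nat) (c : R) :
  sym_int m (fun=> c) = 2 * m%:R * c.
Proof.
rewrite /sym_int Rintegral_cst ?measurable_sym_itv //; last first.
  exact: measurable_sym_itv.
have E : lebesgue_measure (sym_itv R m) = (2 * m%:R)%:E.
  rewrite (lebesgue_measure_itv `[- m%:R, m%:R]) /= lte_fin.
  case: ifPn => [_|]; first by rewrite -EFinB; congr (_%:E); ring.
  case: m => [|m]; first by rewrite mulr0.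
  by rewrite gtrN // ltr0n.
rewrite mulrC; congr (_ * _); exact: (congr1 fine E).
Qed.

Lemma continuousX2 (R : realType) (f : R -> R) :
  continuous f -> continuous (fun x => f x ^+ 2).
Proof. by move=> fc x; apply: cvgM; exact: fc. Qed.

Lemma continuous_mull (R : realType) (c : R) (f : R -> R) :
  continuous f -> continuous (fun x => c * f x).
Proof. by move=> fc x; apply: cvgMr; exact: fc. Qed.

Lemma continuous_rm_sum (R : realType) (q : nat -> nat -> R -> R) (T : nat) :
  (forall a b, continuous (q a b)) ->
  continuous (fun x => rm_sum (fun a b => q a b x) T).
Proof.
move=> qc; apply: continuous_bigsum => p x.
apply: cvgD; first by apply: cvgMr; exact: qc.
apply: cvgMr; apply: continuous_bigsum => i; apply: continuous_bigsum => l.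
exact: qc.
Qed.

Lemma sym_int_rm_sum (R : realType) (q : nat -> nat -> R -> R) (T m : nat) :
  (forall a b, continuous (q a b)) ->
  sym_int m (fun x => rm_sum (fun a b => q a b x) T) =
  rm_sum (fun a b => sym_int m (q a b)) T.
Proof.
move=> qc.
have dc p i : continuous (fun x => dyadic_sum (fun a b => q a b x) (2 ^ p) p i).
  by apply: continuous_bigsum.
have sc p : continuous (fun x =>
    \sum_(0 <= i < p) dyadic_sum (fun a b => q a b x) (2 ^ p) p i).
  by apply: continuous_bigsum.
rewrite /rm_sum sym_int_sum; last first.
  by move=> p x; apply: cvgD; apply: cvgMr; [exact: qc|exact: sc].
apply: eq_bigr => p _; rewrite sym_intD; last 2 first.
- exact: continuous_mull.
- exact: continuous_mull.
rewrite !sym_intZ // sym_int_sum //; congr (_ + _ * _).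
by apply: eq_bigr => i _; rewrite /dyadic_sum sym_int_sum.
Qed.

Definition dilated_sum (R : realType) (k : nat -> nat) (N J : nat)
    (b : nat -> nat -> R) (x : R) : R :=
  \sum_(1 <= n < N) sine_psum (b n) J ((k n)%:R * x).

Lemma continuous_dilated_sum (R : realType) (k : nat -> nat) (N J : nat)
    (b : nat -> nat -> R) : continuous (dilated_sum k N J b).
Proof.
apply: continuous_bigsum => n.
have : continuous (sine_psum (b n) J \o (fun y => (k n)%:R * y)).
  move=> x; apply: continuous_comp; first exact: mulrl_continuous.
  exact: continuous_sine_psum.
exact.
Qed.

Definition dilated_degree (k : nat -> nat) (N J : nat) : nat :=
  (\sum_(1 <= n < N) k n * J)%N.

Lemma dilated_degree_ge (k : nat -> nat) (N J n : nat) :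
  (0 < n < N)%N -> (k n * J <= dilated_degree k N J)%N.
Proof.
move=> hn; rewrite /dilated_degree.
by rewrite (bigD1_seq n) ?mem_index_iota ?iota_uniq //= leq_addr.
Qed.

Lemma sym_int_dilated_sum_sqr (R : realType) (k : nat -> nat) (N J m : nat)
    (b : nat -> nat -> R) :
  (0 < m)%N -> (forall n, (0 < n)%N -> (0 < k n)%N) ->
  (forall n j, (J < j)%N -> b n j = 0) ->
  sym_int m (fun x => dilated_sum k N J b x ^+ 2) =
  m%:R * \sum_(1 <= v < (dilated_degree k N J).+1) dilated_coef k N b v ^+ 2.
Proof.
move=> m0 k0 bJ; apply/EFin_inj; rewrite -sym_intE; last first.
  exact/continuousX2/continuous_dilated_sum.
apply: integral_sum_dilated_sqr => // n hn.
exact: dilated_degree_ge.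
Qed.

(** At frequency [v = k n * j] the multiplier of the window depends on [v]
    only, so that it passes inside the sum that defines the coefficient. *)
Lemma dilated_sum_window (R : realType) (k : nat -> nat) (N J : nat)
    (b : nat -> nat -> R) (x h : R) :
  0 < h -> (forall n, (0 < n)%N -> (0 < k n)%N) ->
  (forall n j, (J < j)%N -> b n j = 0) ->
  (\int[lebesgue_measure]_(y in `[(x - h)%R, (x + h)%R])
     (dilated_sum k N J b y)%:E)%E =
  (2 * h * dilated_sum k N J
     (fun n j => b n j * sinc (2 * pi * (k n * j)%N%:R * h)) x)%:E.
Proof.
move=> h0 k0 bJ; set V := dilated_degree k N J.
have kV n : (0 < n < N)%N -> (k n * J <= V)%N by exact: dilated_degree_ge.
transitivity (\int[lebesgue_measure]_(y in `[(x - h)%R, (x + h)%R])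
     (sine_psum (dilated_coef k N b) V y)%:E)%E.
  apply: eq_integral => y _; congr (_%:E).
  exact: sum_dilated_sine_psum.
rewrite integral_sine_psum_window // /dilated_sum.
rewrite (sum_dilated_sine_psum (V := V) _ k0 kV); last first.
  by move=> n j Jj; rewrite bJ // mul0r.
congr (_ * _)%:E; apply: eq_bigr => v _; congr (_ * _).
rewrite /dilated_coef mulr_suml; apply: eq_bigr => n kn.
by rewrite mulnC divnK.
Qed.

(** * Square norms of the truncated series *)

(** An integer version of [1 + log n], also for [n = 1]. *)
Definition layer (n : nat) : nat := (trunc_log 2 n).+1.

(** A power of [n] up to a bounded factor; dyadic values make the harmonic and
    geometric estimates above directly applicable. *)
Definition cut (C n : nat) : nat := (2 ^ (C * layer n))%N.

Definition cut_coef (R : realType) (a : nat -> R) (C n j : nat) : R :=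
  if (j < cut C n)%N then a j else 0.

Lemma layer_le (n T : nat) : (0 < n < 2 ^ T)%N -> (layer n <= T)%N.
Proof.
move=> /andP[n0 nT]; rewrite /layer -(ltn_exp2l (m := 2)) //.
by apply: leq_ltn_trans nT; have /andP[] := trunc_log_bounds (ltnSn 1) n0.
Qed.

Lemma cut_le (C n T : nat) : (0 < n < 2 ^ T)%N -> (cut C n <= 2 ^ (C * T))%N.
Proof.
by move=> hn; rewrite /cut leq_exp2l // leq_mul2l layer_le ?orbT.
Qed.

Definition energy (R : realType) (w : nat -> R) (k : nat -> nat) (c : nat -> R)
    (T : nat) : R :=
  \sum_(1 <= n < 2 ^ T) c n ^+ 2 * divisor_sum w (k n) * (layer n)%:R ^+ 2.

Definition filtered_coef (R : realType) (a : nat -> R) (C : nat)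
    (c : nat -> R) (mu : nat -> nat -> R) (n j : nat) : R :=
  c n * cut_coef a C n j * mu n j.

Lemma filtered_coef_eq0 (R : realType) (a : nat -> R) (C T : nat)
    (c : nat -> R) (mu : nat -> nat -> R) (n j : nat) :
  (forall n, ~~ (0 < n < 2 ^ T)%N -> c n = 0) -> (2 ^ (C * T) <= j)%N ->
  filtered_coef a C c mu n j = 0.
Proof.
move=> cT Tj; rewrite /filtered_coef.
have [hn|/cT ->] := boolP (0 < n < 2 ^ T)%N; last by rewrite !mul0r.
rewrite /cut_coef ltnNge (leq_trans (cut_le C hn) Tj) /=.
by rewrite mulr0 mul0r.
Qed.

Lemma sym_int_filtered_sqr_le (R : realType) (w : nat -> R) (Z A : R)
    (k : nat -> nat) (a : nat -> R) (C T m : nat) (c : nat -> R)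
    (mu : nat -> nat -> R) :
  mult_weight w Z -> (forall n, (0 < n)%N -> (0 < k n)%N) ->
  {in [pred n | (0 < n)%N] &, injective k} ->
  0 <= A -> (forall j, (0 < j)%N -> a j ^+ 2 <= A * (w j / j%:R)) ->
  (0 < m)%N -> (forall n, ~~ (0 < n < 2 ^ T)%N -> c n = 0) ->
  sym_int m (fun x => dilated_sum k (2 ^ T) (2 ^ (C * T))
                        (filtered_coef a C c mu) x ^+ 2) <=
  m%:R * A * \sum_(1 <= n < 2 ^ T) c n ^+ 2 * divisor_sum w (k n) *
    \sum_(1 <= j < cut C n) mu n j ^+ 2 * (divisor_sum w j / j%:R).
Proof.
move=> hw k0 kinj A0 aA m0 cT; have [w0 _ _] := hw.
rewrite sym_int_dilated_sum_sqr //; last first.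
  by move=> n j /ltnW; exact: filtered_coef_eq0.
rewrite -mulrA ler_wpM2l //.
pose nu n j := if (j < cut C n)%N then mu n j ^+ 2 else 0.
have nu0 n j : 0 <= nu n j by rewrite /nu; case: ifP => // _; exact: sqr_ge0.
apply: le_trans (dilated_coef_sqr_le_log (w := w) (J := 2 ^ (C * T))
  (mu := nu) (x := fun n => A * c n ^+ 2) _ _ hw k0 kinj _ nu0 _ _) _.
- by move=> n; rewrite mulr_ge0 ?sqr_ge0.
- move=> n j n0 j0 _; rewrite /filtered_coef /cut_coef /nu.
  case: ifP => _; last by rewrite !(mulr0, mul0r) expr0n.
  have -> : (c n * a j * mu n j) ^+ 2 = (c n ^+ 2 * mu n j ^+ 2) * a j ^+ 2 by ring.
  have -> : A * c n ^+ 2 * mu n j ^+ 2 * (w j / j%:R) =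
    (c n ^+ 2 * mu n j ^+ 2) * (A * (w j / j%:R)) by ring.
  by apply: ler_wpM2l; [rewrite mulr_ge0 ?sqr_ge0|exact: aA].
- by move=> n j; exact: filtered_coef_eq0.
rewrite mulr_sumr; apply: ler_sum_nat => n hn.
move: (c n ^+ 2) (sqr_ge0 (c n)) => c2 c20; rewrite -!mulrA.
apply: ler_wpM2l => //; apply: ler_wpM2l => //.
apply: ler_wpM2l; first exact: divisor_sum_ge0 hw.
rewrite (@big_cat_nat _ _ _ (cut C n)) ?expn_gt0 ?cut_le //=.
rewrite [X in _ + X]big_nat_cond [X in _ + X]big1 ?addr0; last first.
  by move=> j; rewrite andbT /nu => /andP[]; rewrite leqNgt => /negbTE -> _; rewrite mul0r.
by apply: ler_sum_nat => j /andP[_ jc]; rewrite /nu jc.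
Qed.

Lemma sum_cut_divisor_sum_le (R : realType) (w : nat -> R) (Z : R) (C n : nat) :
  mult_weight w Z ->
  \sum_(1 <= j < cut C n) divisor_sum w j / j%:R <= Z * C%:R * (layer n)%:R.
Proof.
by move=> hw; rewrite -mulrA -natrM; exact: sum_divisor_sum_le.
Qed.

Lemma layer_sqr_ge (R : realType) (n : nat) :
  (layer n)%:R <= (layer n)%:R ^+ 2 :> R.
Proof. by rewrite -natrX ler_nat /layer; nia. Qed.

Lemma sym_int_total_sqr_le (R : realType) (w : nat -> R) (Z A : R)
    (k : nat -> nat) (a : nat -> R) (C T m : nat) (c : nat -> R) :
  mult_weight w Z -> (forall n, (0 < n)%N -> (0 < k n)%N) ->
  {in [pred n | (0 < n)%N] &, injective k} ->
  0 <= A -> (forall j, (0 < j)%N -> a j ^+ 2 <= A * (w j / j%:R)) ->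
  (0 < m)%N -> (forall n, ~~ (0 < n < 2 ^ T)%N -> c n = 0) ->
  sym_int m (fun x => dilated_sum k (2 ^ T) (2 ^ (C * T))
                        (filtered_coef a C c (fun _ _ => 1)) x ^+ 2) <=
  m%:R * A * (Z * C%:R) * energy w k c T.
Proof.
move=> hw k0 kinj A0 aA m0 cT.
apply: le_trans (sym_int_filtered_sqr_le C _ hw k0 kinj A0 aA m0 cT) _.
rewrite -[leRHS]mulrA ler_wpM2l ?mulr_ge0 // /energy mulr_sumr.
have Z0 := mult_weight_bound_ge0 hw.
apply: ler_sum_nat => n hn.
have cD0 : 0 <= c n ^+ 2 * divisor_sum w (k n).
  exact: mulr_ge0 (sqr_ge0 _) (divisor_sum_ge0 _ hw).
rewrite [leRHS]mulrCA; apply: ler_wpM2l => //.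
under eq_bigr do rewrite expr1n mul1r.
apply: le_trans (sum_cut_divisor_sum_le C n hw) _.
by rewrite ler_wpM2l ?mulr_ge0 // layer_sqr_ge.
Qed.

(** The multiplier of the sum of the terms with [k n < 2^Q], minus that of the
    average over a window of half-length [2^-Q]. *)
Definition window_defect (R : realType) (k : nat -> nat) (Q n j : nat) : R :=
  (k n < 2 ^ Q)%N%:R - sinc (2 * pi * (k n * j)%N%:R * (2 ^ Q)%N%:R^-1).

(** One logarithm comes from the sum over [Q] of the squared multipliers, the
    other one from the sum over [j]. *)
Lemma sum_sym_int_defect_sqr_le (R : realType) (w : nat -> R) (Z A : R)
    (k : nat -> nat) (a : nat -> R) (C T m B : nat) (c : nat -> R) :
  mult_weight w Z -> (forall n, (0 < n)%N -> (0 < k n)%N) ->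
  {in [pred n | (0 < n)%N] &, injective k} ->
  0 <= A -> (forall j, (0 < j)%N -> a j ^+ 2 <= A * (w j / j%:R)) ->
  (0 < m)%N -> (forall n, ~~ (0 < n < 2 ^ T)%N -> c n = 0) ->
  \sum_(0 <= Q < B)
    sym_int m (fun x => dilated_sum k (2 ^ T) (2 ^ (C * T))
                        (filtered_coef a C c (window_defect R k Q)) x ^+ 2) <=
  m%:R * A * (130 * C.+1%:R * (Z * C%:R)) * energy w k c T.
Proof.
move=> hw k0 kinj A0 aA m0 cT; have Z0 := mult_weight_bound_ge0 hw.
apply: le_trans (ler_sum_nat (fun Q _ => sym_int_filtered_sqr_le C
   (window_defect R k Q) hw k0 kinj A0 aA m0 cT)) _.
rewrite -mulr_sumr -[leRHS]mulrA ler_wpM2l ?mulr_ge0 //.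
rewrite exchange_big /= /energy mulr_sumr.
apply: ler_sum_nat => n /andP[n0 _].
have cD0 : 0 <= c n ^+ 2 * divisor_sum w (k n).
  exact: mulr_ge0 (sqr_ge0 _) (divisor_sum_ge0 _ hw).
rewrite -mulr_sumr [leRHS]mulrCA; apply: ler_wpM2l => //.
rewrite exchange_big /=.
apply: (@le_trans _ _ (\sum_(1 <= j < cut C n)
   130 * (C * layer n).+1%:R * (divisor_sum w j / j%:R))).
  apply: ler_sum_nat => j hj; rewrite -mulr_suml.
  rewrite ler_wpM2r ?divr_ge0 ?(divisor_sum_ge0 _ hw) //.
  by apply: sum_window_multiplier_le; rewrite ?k0.
rewrite -mulr_sumr.
apply: (@le_trans _ _ (130 * (C * layer n).+1%:R * (Z * C%:R * (layer n)%:R))).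
  by rewrite ler_wpM2l ?mulr_ge0 // sum_cut_divisor_sum_le.
have -> : 130 * C.+1%:R * (Z * C%:R) * (layer n)%:R ^+ 2 =
  130 * (C.+1%:R * (layer n)%:R) * (Z * C%:R * (layer n)%:R) by ring.
rewrite ler_wpM2r ?mulr_ge0 // ler_wpM2l // -natrM ler_nat /layer; nia.
Qed.

Definition block_coef (R : realType) (k : nat -> nat) (q : nat) (c : nat -> R)
    (n : nat) : R :=
  if (2 ^ q <= k n < 2 ^ q.+1)%N then c n else 0.

(** The coefficients [block_coef] select the dilations in one dyadic block,
    where the quadratic form has no logarithmic loss. *)
Lemma sym_int_block_sqr_le (R : realType) (w : nat -> R) (Z A : R)
    (k : nat -> nat) (a : nat -> R) (C T m q : nat) (c : nat -> R) :
  mult_weight w Z -> (forall n, (0 < n)%N -> (0 < k n)%N) ->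
  {in [pred n | (0 < n)%N] &, injective k} ->
  0 <= A -> (forall j, (0 < j)%N -> a j ^+ 2 <= A * (w j / j%:R)) ->
  (0 < m)%N -> (forall n, ~~ (0 < n < 2 ^ T)%N -> c n = 0) ->
  sym_int m (fun x => dilated_sum k (2 ^ T) (2 ^ (C * T))
     (filtered_coef a C (block_coef k q c) (fun _ _ => 1)) x ^+ 2) <=
  m%:R * A * (4 * Z) *
    \sum_(1 <= n < 2 ^ T) block_coef k q c n ^+ 2 * divisor_sum w (k n).
Proof.
move=> hw k0 kinj A0 aA m0 cT; have Z0 := mult_weight_bound_ge0 hw.
have [w0 _ _] := hw.
have cT' n : ~~ (0 < n < 2 ^ T)%N -> block_coef k q c n = 0.
  by rewrite /block_coef; case: ifP => // _; exact: cT.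
rewrite sym_int_dilated_sum_sqr //; last first.
  by move=> n j /ltnW; exact: filtered_coef_eq0.
rewrite -[leRHS]mulrA -[leRHS]mulrA ler_wpM2l //.
pose I n := (2 ^ q <= k n < 2 * 2 ^ q)%N.
have IE n : block_coef k q c n = if I n then c n else 0.
  by rewrite /block_coef /I expnS.
apply: le_trans (dilated_coef_sqr_le_block (w := w) (J := 2 ^ (C * T)) (I := I)
  (K := 2 ^ q) (x := fun n => A * block_coef k q c n ^+ 2) _ _ hw k0 kinj
  _ _ _ _) _.
- by move=> n; rewrite mulr_ge0 ?sqr_ge0.
- by move=> n.
- move=> n j n0 j0 In _; rewrite /filtered_coef /cut_coef mulr1.
  case: ifP => _; last first.
    rewrite mulr0 expr0n /=; apply: mulr_ge0; last exact: divr_ge0.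
    by apply: mulr_ge0 => //; exact: sqr_ge0.
  rewrite exprMn -[leRHS]mulrA [leRHS]mulrCA.
  by apply: ler_wpM2l; [exact: sqr_ge0|exact: aA].
- move=> n j; rewrite negb_and => /orP[/negbTE nI|]; last first.
    by rewrite -leqNgt; exact: filtered_coef_eq0.
  by rewrite /filtered_coef IE nI !mul0r.
rewrite [leRHS]mulrCA ler_wpM2l ?mulr_ge0 //.
rewrite mulr_sumr big_mkcond; apply: ler_sum => n _.
case: ifP => _; first by rewrite [leRHS]mulrA.
apply: mulr_ge0 => //.
exact: mulr_ge0 (sqr_ge0 _) (divisor_sum_ge0 _ hw).
Qed.

(** * Partial sums inside a dyadic block of dilations *)

Lemma sum_nat_segE (R : realType) (F : nat -> R) (p q M : nat) :
  (q <= M)%N ->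
  \sum_(p <= n < q) F n = \sum_(0 <= n < M | (p <= n < q)%N) F n.
Proof.
move=> qM; rewrite (big_nat_widenl _ 0) //= (big_nat_widen _ _ M) //=.
Qed.

Definition seg_coef (R : realType) (p q : nat) (c : nat -> R) (n : nat) : R :=
  if (p <= n < q)%N then c n else 0.

Lemma sum_seg_coef (R : realType) (c P : nat -> R) (N p q : nat) :
  (forall n, ~~ (0 < n < N)%N -> c n = 0) ->
  \sum_(p <= n < q) c n * P n = \sum_(1 <= n < N) seg_coef p q c n * P n.
Proof.
move=> cN; rewrite (@sum_nat_segE _ _ p q (q + N)) ?leq_addr //.
rewrite (@sum_nat_segE _ _ 1 N (q + N)) ?leq_addl //.
rewrite big_mkcond [RHS]big_mkcond; apply: eq_bigr => n _.
rewrite /seg_coef; have [hn|/cN ->] := boolP (0 < n < N)%N.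
  by case: ifP; rewrite ?mul0r.
by rewrite mul0r if_same.
Qed.

Lemma dilated_sum_filtered1 (R : realType) (k : nat -> nat) (a : nat -> R)
    (C N J : nat) (c : nat -> R) (x : R) :
  dilated_sum k N J (filtered_coef a C c (fun _ _ => 1)) x =
  \sum_(1 <= n < N) c n * sine_psum (cut_coef a C n) J ((k n)%:R * x).
Proof.
apply: eq_bigr => n _; rewrite /sine_psum mulr_sumr; apply: eq_bigr => j _.
by rewrite /filtered_coef mulr1 [RHS]mulrA.
Qed.

Lemma sine_psum_cut (R : realType) (a : nat -> R) (C T n : nat) (y : R) :
  (0 < n < 2 ^ T)%N ->
  sine_psum (cut_coef a C n) (2 ^ (C * T)) y = sine_psum a (cut C n).-1 y.
Proof.
move=> hn; have c0 : (0 < cut C n)%N by rewrite expn_gt0.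
have cT := cut_le C hn.
rewrite /sine_psum prednK // (@big_cat_nat _ _ _ (cut C n)) //=; last first.
  exact: leqW.
rewrite [X in _ + X]big_nat_cond [X in _ + X]big1 ?addr0; last first.
  move=> j; rewrite andbT /cut_coef => /andP[].
  by rewrite leqNgt => /negbTE -> _; rewrite mul0r.
by apply: eq_big_nat => j /andP[_ jc]; rewrite /cut_coef jc.
Qed.

Lemma sum_block_coef_sqr_le (R : realType) (k : nat -> nat) (c : nat -> R)
    (n B : nat) : (0 < k n)%N ->
  \sum_(0 <= q < B) block_coef k q c n ^+ 2 <= c n ^+ 2.
Proof.
move=> kn; have E q : block_coef k q c n =
    if q == trunc_log 2 (k n) then c n else 0.
  rewrite /block_coef; case: ifP => [/(trunc_log_eq (ltnSn 1)) ->|].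
    by rewrite eqxx.
  case: eqVneq => // ->.
  by have /= -> := trunc_log_bounds (ltnSn 1) kn.
have [qB|Bq] := ltnP (trunc_log 2 (k n)) B.
  rewrite (bigD1_seq (trunc_log 2 (k n))) ?mem_index_iota ?iota_uniq //=.
  rewrite E eqxx big1 ?addr0 // => q /negbTE qn.
  by rewrite E qn expr0n.
rewrite big_nat_cond big1 ?sqr_ge0 // => q; rewrite andbT => /andP[_ qB].
by rewrite E (ltn_eqF (leq_trans qB Bq)) expr0n.
Qed.

Definition block_term (R : realType) (k : nat -> nat) (a : nat -> R)
    (C T q : nat) (c : nat -> R) (x : R) (n : nat) : R :=
  block_coef k q c n *
  sine_psum (cut_coef a C n) (2 ^ (C * T)) ((k n)%:R * x).

Definition block_maximal (R : realType) (k : nat -> nat) (a : nat -> R)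
    (C T B : nat) (c : nat -> R) (x : R) : R :=
  \sum_(0 <= q < B)
    rm_sum (fun p p' => (\sum_(p <= n < p') block_term k a C T q c x n) ^+ 2) T.

Lemma continuous_block_segment (R : realType) (k : nat -> nat) (a : nat -> R)
    (C T q : nat) (c : nat -> R) (p p' : nat) :
  continuous (fun x => \sum_(p <= n < p') block_term k a C T q c x n).
Proof.
apply: continuous_bigsum => n; apply: continuous_mull.
have : continuous (sine_psum (cut_coef a C n) (2 ^ (C * T)) \o
    (fun y => (k n)%:R * y)).
  move=> x; apply: continuous_comp; first exact: mulrl_continuous.
  exact: continuous_sine_psum.
exact.
Qed.

Lemma continuous_block_maximal (R : realType) (k : nat -> nat) (a : nat -> R)
    (C T B : nat) (c : nat -> R) : continuous (block_maximal k a C T B c).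
Proof.
apply: continuous_bigsum => q; apply: continuous_rm_sum => p p'.
exact/continuousX2/continuous_block_segment.
Qed.

(** Each segment of each block satisfies the lossless quadratic bound with an
    additive majorant, to which [rm_sum_additive_le] applies; each [n] belongs
    to a single block. *)
Lemma sym_int_block_maximal_le (R : realType) (w : nat -> R) (Z A : R)
    (k : nat -> nat) (a : nat -> R) (C T m B : nat) (c : nat -> R) :
  mult_weight w Z -> (forall n, (0 < n)%N -> (0 < k n)%N) ->
  {in [pred n | (0 < n)%N] &, injective k} ->
  0 <= A -> (forall j, (0 < j)%N -> a j ^+ 2 <= A * (w j / j%:R)) ->
  (0 < m)%N -> (forall n, ~~ (0 < n < 2 ^ T)%N -> c n = 0) ->
  sym_int m (block_maximal k a C T B c) <=
  m%:R * A * (24 * Z) * energy w k c T.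
Proof.
move=> hw k0 kinj A0 aA m0 cT; have Z0 := mult_weight_bound_ge0 hw.
have D0 n := divisor_sum_ge0 (k n) hw.
have cont q p p' := continuousX2 (@continuous_block_segment
  R k a C T q c p p').
have segment q p p' :
    sym_int m (fun x => (\sum_(p <= n < p') block_term k a C T q c x n) ^+ 2)
    <= \sum_(p <= n < p') m%:R * A * (4 * Z) *
         (block_coef k q c n ^+ 2 * divisor_sum w (k n)).
  pose c' := seg_coef p p' c.
  have cT' n : ~~ (0 < n < 2 ^ T)%N -> c' n = 0.
    by rewrite /c' /seg_coef; case: ifP => // _; exact: cT.
  have bT n : ~~ (0 < n < 2 ^ T)%N -> block_coef k q c n = 0.
    by rewrite /block_coef; case: ifP => // _; exact: cT.
  have bE n : block_coef k q c' n = seg_coef p p' (block_coef k q c) n.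
    by rewrite /block_coef /c' /seg_coef; case: ifP => //; case: ifP.
  have := sym_int_block_sqr_le C q hw k0 kinj A0 aA m0 cT'.
  have -> : (fun x => dilated_sum k (2 ^ T) (2 ^ (C * T))
     (filtered_coef a C (block_coef k q c') (fun _ _ => 1)) x ^+ 2) =
     (fun x => (\sum_(p <= n < p') block_term k a C T q c x n) ^+ 2).
    apply/funext => x; rewrite dilated_sum_filtered1 /block_term.
    rewrite (sum_seg_coef (fun n => sine_psum (cut_coef a C n) (2 ^ (C * T))
      ((k n)%:R * x)) p p' bT).
    by congr (_ ^+ 2); apply: eq_bigr => n _; rewrite bE.
  move=> /le_trans; apply; rewrite -mulr_sumr.
  apply: ler_wpM2l; first by rewrite !mulr_ge0.
  have -> : \sum_(p <= n < p') block_coef k q c n ^+ 2 * divisor_sum w (k n) =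
      \sum_(1 <= n < 2 ^ T) seg_coef p p' (fun n => block_coef k q c n ^+ 2) n
        * divisor_sum w (k n).
    by apply: sum_seg_coef => n /bT ->; rewrite expr0n.
  apply: ler_sum => n _; rewrite bE /seg_coef; case: ifP => // _.
  by rewrite expr0n.
rewrite /block_maximal sym_int_sum; last first.
  by move=> q; apply: continuous_rm_sum => p p'; exact: cont.
apply: (@le_trans _ _ (\sum_(0 <= q < B) 6 * \sum_(1 <= n < 2 ^ T)
    (layer n)%:R ^+ 2 * (m%:R * A * (4 * Z) *
         (block_coef k q c n ^+ 2 * divisor_sum w (k n))))).
  apply: ler_sum => q _; rewrite sym_int_rm_sum //.
  apply: le_trans (ler_rm_sum T (segment q)) _.
  apply: rm_sum_additive_le => n; apply: mulr_ge0; first by rewrite !mulr_ge0.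
  by apply: mulr_ge0 => //; exact: sqr_ge0.
rewrite -mulr_sumr exchange_big /= /energy [leRHS]mulr_sumr mulr_sumr.
apply: ler_sum_nat => n /andP[n0 _].
have K0 : 0 <= m%:R * A * (24 * Z) * divisor_sum w (k n) * (layer n)%:R ^+ 2.
  by apply: mulr_ge0; [rewrite !mulr_ge0|exact: sqr_ge0].
have -> : 6 * \sum_(0 <= q < B) (layer n)%:R ^+ 2 * (m%:R * A * (4 * Z) *
     (block_coef k q c n ^+ 2 * divisor_sum w (k n))) =
   m%:R * A * (24 * Z) * divisor_sum w (k n) * (layer n)%:R ^+ 2 *
     \sum_(0 <= q < B) block_coef k q c n ^+ 2.
  by rewrite [LHS]mulr_sumr [RHS]mulr_sumr; apply: eq_bigr => q _; ring.
have -> : m%:R * A * (24 * Z) *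
    (c n ^+ 2 * divisor_sum w (k n) * (layer n)%:R ^+ 2) =
   m%:R * A * (24 * Z) * divisor_sum w (k n) * (layer n)%:R ^+ 2 * c n ^+ 2.
  by ring.
by apply: ler_wpM2l => //; apply: sum_block_coef_sqr_le; exact: k0.
Qed.

(** * The maximal inequality *)

Lemma increasing_lt (k : nat -> nat) (m n : nat) :
  (forall n, (0 < n)%N -> (k n < k n.+1)%N) -> (0 < m)%N -> (m < n)%N ->
  (k m < k n)%N.
Proof.
move=> kS m0; elim: n => // n IH; rewrite ltnS leq_eqVlt => /predU1P[<-|mn].
  exact: kS.
by rewrite (ltn_trans (IH mn)) // kS // (ltn_trans m0).
Qed.

Lemma increasing_inj (k : nat -> nat) :
  (forall n, (0 < n)%N -> (k n < k n.+1)%N) ->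
  {in [pred n | (0 < n)%N] &, injective k}.
Proof.
move=> kS m n; rewrite !inE => m0 n0 kmn.
have [mn|nm|//] := ltngtP m n.
  by have := increasing_lt kS m0 mn; rewrite kmn ltnn.
by have := increasing_lt kS n0 nm; rewrite kmn ltnn.
Qed.

Lemma dilated_sumD (R : realType) (k : nat -> nat) (N J : nat)
    (b b' b'' : nat -> nat -> R) (x : R) :
  (forall n j, b n j = b' n j + b'' n j) ->
  dilated_sum k N J b x = dilated_sum k N J b' x + dilated_sum k N J b'' x.
Proof.
move=> bE; rewrite /dilated_sum -big_split /=; apply: eq_bigr => n _.
rewrite /sine_psum -big_split /=; apply: eq_bigr => j _.
by rewrite bE mulrDl.
Qed.

(** As [k] increases, the terms up to [M] are all those with [k n < 2^q] and
    the first ones of the block [q] that contains [k M]. The former are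
    replaced by the window average plus the defect. *)
Lemma partial_sum_split (R : realType) (k : nat -> nat) (a c : nat -> R)
    (C T M : nat) (x : R) :
  (forall n, (0 < n)%N -> (k n < k n.+1)%N) ->
  (forall n, (0 < n)%N -> (0 < k n)%N) ->
  (forall n, ~~ (0 < n < 2 ^ T)%N -> c n = 0) -> (0 < M)%N ->
  let q := trunc_log 2 (k M) in
  let h := (2 ^ q)%N%:R^-1 : R in
  \sum_(1 <= n < M.+1)
     c n * sine_psum (cut_coef a C n) (2 ^ (C * T)) ((k n)%:R * x) =
  dilated_sum k (2 ^ T) (2 ^ (C * T)) (fun n j =>
     filtered_coef a C c (fun _ _ => 1) n j * sinc (2 * pi * (k n * j)%N%:R * h)) x
  + dilated_sum k (2 ^ T) (2 ^ (C * T))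
     (filtered_coef a C c (window_defect R k q)) x
  + \sum_(1 <= n < M.+1) block_term k a C T q c x n.
Proof.
move=> kS k0 cT M0 q h.
have /= /andP[qk kq] := trunc_log_bounds (ltnSn 1) (k0 _ M0).
rewrite -/q in qk kq.
(* Filtering by [k n < 2^q] is the sum of the two multipliers on the right. *)
rewrite -(@dilated_sumD _ _ _ _ (filtered_coef a C
    (fun n => (k n < 2 ^ q)%N%:R * c n) (fun _ _ => 1))); last first.
  move=> n j; rewrite /filtered_coef /window_defect -/h.
  by rewrite mulr1; set S := sinc _; ring.
rewrite dilated_sum_filtered1 /block_term.
have bT n : ~~ (0 < n < 2 ^ T)%N -> block_coef k q c n = 0.
  by rewrite /block_coef; case: ifP => // _; exact: cT.
rewrite (sum_seg_coef _ 1 M.+1 cT) (sum_seg_coef _ 1 M.+1 bT).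
rewrite -big_split /=; apply: eq_big_nat => n /andP[n0 _].
rewrite -mulrDl; congr (_ * _); rewrite /seg_coef /block_coef n0 /= ltnS.
have [nM|Mn] := leqP n M.
  have knM : (k n <= k M)%N.
    move: nM; rewrite leq_eqVlt => /predU1P[->//|nM].
    exact/ltnW/increasing_lt.
  rewrite (leq_ltn_trans knM kq) andbT ltnNge.
  by case: (2 ^ q <= k n)%N; rewrite ?mul0r ?mul1r ?add0r ?addr0.
have kMn : (k M < k n)%N by exact: increasing_lt.
by rewrite ltnNge (leq_trans qk (ltnW kMn)) mul0r addr0.
Qed.

(** [|H| <= t + H^2 / t]. Optimizing in [t] would give Cauchy-Schwarz; it is
    chosen together with the other parameters in
    [ae_cvgn_truncated_series]. *)
Lemma sym_int_abs_le (R : realType) (H : R -> R) (m : nat) (t : R) :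
  continuous H -> 0 < t ->
  sym_int m (fun x => `|H x|) <=
  2 * m%:R * t + t^-1 * sym_int m (fun x => H x ^+ 2).
Proof.
move=> Hc t0; have H2c := continuousX2 Hc.
rewrite -sym_int_cst -sym_intZ // -sym_intD; last 2 first.
- exact: cst_continuous.
- exact: continuous_mull.
apply: le_sym_int.
- by move=> x; apply: continuous_comp; [exact: Hc|exact: norm_continuous].
- have H2c' := continuous_mull (c := t^-1) H2c.
  by move=> x; apply: cvgD; [exact: cvg_cst|exact: H2c'].
move=> x; have [Hx|tH] := leP `|H x| t.
  by rewrite ler_wpDr // mulr_ge0 ?sqr_ge0 // invr_ge0 ltW.
apply: ler_wpDl; first exact: ltW.
rewrite ler_pdivlMl // -[leRHS]real_normK ?num_real // expr2.
by rewrite ler_wpM2r // ltW.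
Qed.

(** The exceptional set is the union of three: a window average exceeds [l],
    the sum over [q] of the squared defects reaches [l^2], or the block maximal
    function reaches [l^2]. Outside of it the three parts of
    [partial_sum_split] are at most [l] each. *)
Theorem dilated_maximal_inequality (R : realType) (w : nat -> R) (Z A : R)
    (k : nat -> nat) (a : nat -> R) (C m : nat) :
  mult_weight w Z -> (forall n, (0 < n)%N -> (0 < k n)%N) ->
  (forall n, (0 < n)%N -> (k n < k n.+1)%N) ->
  0 <= A -> (forall j, (0 < j)%N -> a j ^+ 2 <= A * (w j / j%:R)) ->
  (0 < m)%N ->
  exists K : R, 0 <= K /\ forall (T : nat) (c : nat -> R) (l t : R),
    (forall n, ~~ (0 < n < 2 ^ T)%N -> c n = 0) -> 0 < l -> 0 < t ->
    exists B : set R, [/\ measurable B,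
      (lebesgue_measure B <= (K * (t / l + energy w k c T / (t * l)
                                   + energy w k c T / l ^+ 2))%:E)%E
    & forall x M, sym_itv R m x -> ~ B x -> (M.+1 < 2 ^ T)%N ->
       `|\sum_(1 <= n < M.+1) c n * sine_psum a (cut C n).-1 ((k n)%:R * x)|
         <= 3 * l].
Proof.
move=> hw k0 kS A0 aA m0; have Z0 := mult_weight_bound_ge0 hw.
have kinj := increasing_inj kS.
pose K1 : R := 6 * m.+1%:R.
pose K2 : R := 3 * (m.+1%:R * A * (Z * C%:R)).
pose K3 : R := m%:R * A * (130 * C.+1%:R * (Z * C%:R)).
pose K4 : R := m%:R * A * (24 * Z).
have K10 : 0 <= K1 by rewrite mulr_ge0.
have K20 : 0 <= K2 by rewrite !mulr_ge0.
have K30 : 0 <= K3 by rewrite !mulr_ge0.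
have K40 : 0 <= K4 by rewrite !mulr_ge0.
exists (K1 + K2 + K3 + K4); split; first by rewrite !addr_ge0.
move=> T c l t cT l0 t0.
set N := (2 ^ T)%N; set J := (2 ^ (C * T))%N.
set E := energy w k c T.
have E0 : 0 <= E.
  apply: sumr_ge0 => n _; apply: mulr_ge0; last exact: sqr_ge0.
  by apply: mulr_ge0; [exact: sqr_ge0|exact: divisor_sum_ge0 hw].
pose b := filtered_coef a C c (fun _ _ => 1).
pose H := dilated_sum k N J b.
have Hc : continuous H by exact: continuous_dilated_sum.
pose B := (trunc_log 2 (k N)).+1.
pose Ed q := dilated_sum k N J (filtered_coef a C c (window_defect R k q)).
pose G1 x := \sum_(0 <= q < B) Ed q x ^+ 2.
have Edc q : continuous (Ed q) by exact: continuous_dilated_sum.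
have G1c : continuous G1 by apply: continuous_bigsum => q; exact: continuousX2.
pose G2 := block_maximal k a C T B c.
have G2c : continuous G2 by exact: continuous_block_maximal.
have rm0 q x : 0 <= rm_sum (fun p p' =>
    (\sum_(p <= n < p') block_term k a C T q c x n) ^+ 2) T.
  apply: sumr_ge0 => p _; apply: addr_ge0.
    apply: mulr_ge0; last exact: sqr_ge0.
    by apply: mulr_ge0 => //; exact: sqr_ge0.
  apply: mulr_ge0; first exact: mulr_ge0.
  by apply: sumr_ge0 => i _; apply: sumr_ge0 => ? _; exact: sqr_ge0.
have G10 x : 0 <= G1 x by apply: sumr_ge0 => q _; exact: sqr_ge0.
have G20 x : 0 <= G2 x by apply: sumr_ge0 => q _; exact: rm0.
have l20 : 0 < l ^+ 2 by rewrite exprn_gt0.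
have [B0 [mB0 hB0 B0P]] := window_average_exceptional_set m Hc l0.
pose B1 := sym_itv R m `&` [set x | l ^+ 2 <= G1 x].
pose B2 := sym_itv R m `&` [set x | l ^+ 2 <= G2 x].
have mB1 : measurable B1 by exact: measurable_superlevel.
have mB2 : measurable B2 by exact: measurable_superlevel.
exists (B0 `|` B1 `|` B2); split.
- by apply: measurableU => //; exact: measurableU.
- have b0 : (lebesgue_measure B0 <= (K1 * (t / l) + K2 * (E / (t * l)))%:E)%E.
    apply: le_trans hB0 _.
    rewrite sym_intE; last first.
      by move=> x; apply: continuous_comp; [exact: Hc|exact: norm_continuous].
    rewrite -EFinM lee_fin.
    have HE : sym_int m.+1 (fun x => H x ^+ 2) <= m.+1%:R * A * (Z * C%:R) * E.
      exact: sym_int_total_sqr_le.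
    have h3 : 0 <= 3 / l by rewrite divr_ge0 // ltW.
    apply: le_trans (ler_wpM2l h3 (sym_int_abs_le m.+1 Hc t0)) _.
    have ti0 : 0 <= t^-1 by rewrite invr_ge0 ltW.
    apply: (@le_trans _ _ (3 / l * (2 * m.+1%:R * t
        + t^-1 * (m.+1%:R * A * (Z * C%:R) * E)))).
      by apply: ler_wpM2l => //; rewrite lerD2l; exact: ler_wpM2l.
    rewrite le_eqVlt; apply/orP; left; apply/eqP; rewrite /K1 /K2.
    by field; rewrite !gt_eqF.
  have b1 : (lebesgue_measure B1 <= (K3 * E / l ^+ 2)%:E)%E.
    apply: markov_sym_itv => //; rewrite sym_intE // lee_fin.
    rewrite /G1 sym_int_sum; last by move=> q; exact: continuousX2.
    exact: sum_sym_int_defect_sqr_le.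
  have b2 : (lebesgue_measure B2 <= (K4 * E / l ^+ 2)%:E)%E.
    apply: markov_sym_itv => //; rewrite sym_intE // lee_fin.
    exact: sym_int_block_maximal_le.
  apply: le_trans (measureU2 _ _ _) _ => //; first exact: measurableU.
  apply: le_trans (leeD (measureU2 _ _ _) (lexx _)) _ => //.
  apply: le_trans (leeD (leeD b0 b1) b2) _.
  rewrite -!EFinD lee_fin.
  have tl0 : 0 <= t / l by rewrite divr_ge0 // ltW.
  have Etl0 : 0 <= E / (t * l).
    by apply: divr_ge0 => //; apply: mulr_ge0; exact: ltW.
  have El0 : 0 <= E / l ^+ 2 by apply: divr_ge0 => //; exact: ltW.
  rewrite -![_ * E / _]mulrA; nra.
move=> x M xm /not_orP[/not_orP[B0x B1x] B2x] MN.
case: M MN => [|M] MN; first by rewrite big_geq // normr0 mulr_ge0 // ltW.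
have -> : \sum_(1 <= n < M.+2) c n * sine_psum a (cut C n).-1 ((k n)%:R * x) =
    \sum_(1 <= n < M.+2) c n * sine_psum (cut_coef a C n) J ((k n)%:R * x).
  apply: eq_big_nat => n /andP[n0 nM]; rewrite (@sine_psum_cut _ _ _ T) //.
  by rewrite n0 (ltn_trans nM).
rewrite (partial_sum_split a C x kS k0 cT (ltn0Sn M)).
set q := trunc_log 2 (k M.+1); set h := (2 ^ q)%N%:R^-1 : R.
have qB : (q < B)%N.
  rewrite /B ltnS leq_trunc_log //; apply/ltnW/increasing_lt => //.
  exact: ltn_trans MN.
have p20 : 0 < (2 ^ q)%N%:R :> R by rewrite ltr0n expn_gt0.
have h0 : 0 < h by rewrite invr_gt0.
have h1 : h <= 1 by rewrite invf_le1 // ler1n expn_gt0.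
apply: le_trans (ler_normD _ _) _; apply: le_trans (lerD (ler_normD _ _) (lexx _)) _.
have -> : 3 * l = l + l + l by ring.
apply: lerD; first apply: lerD.
- have := B0P x h xm B0x h0 h1; rewrite dilated_sum_window //; last first.
    by move=> n j /ltnW; exact: filtered_coef_eq0.
  rewrite lee_fin normrM gtr0_norm ?mulr_gt0 //.
  by rewrite ler_pM2l ?mulr_gt0.
- have : Ed q x ^+ 2 <= l ^+ 2.
    apply: (@le_trans _ _ (G1 x)).
      rewrite /G1 (bigD1_seq q) ?mem_index_iota ?iota_uniq //= lerDl.
      by apply: sumr_ge0 => ? _; exact: sqr_ge0.
    by rewrite leNgt; apply/negP => /ltW G1l; apply: B1x.
  by rewrite -[in X in X -> _]real_normK ?num_real // ler_pXn2r ?nnegrE // ltW.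
- have : (\sum_(1 <= n < M.+2) block_term k a C T q c x n) ^+ 2 <= l ^+ 2.
    apply: le_trans (partial_sum_sqr_le _ MN) _.
    apply: (@le_trans _ _ (G2 x)).
      rewrite /G2 /block_maximal (bigD1_seq q) ?mem_index_iota ?iota_uniq //=.
      by rewrite lerDl; apply: sumr_ge0 => ? _; exact: rm0.
    by rewrite leNgt; apply/negP => /ltW G2l; apply: B2x.
  by rewrite -[in X in X -> _]real_normK ?num_real // ler_pXn2r ?nnegrE // ltW.
Qed.

(** * Truncation error and size of the hypothesis *)

Lemma bounded_sum_tail (R : realType) (f : nat -> R) (L t : R) :
  (forall n, 0 <= f n) -> (forall N, \sum_(1 <= n < N) f n <= L) -> 0 < t ->
  exists M0, (0 < M0)%N /\ forall M1, \sum_(M0 <= n < M1) f n <= t.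
Proof.
move=> f0 fL t0; pose u N := \sum_(1 <= n < N.+1) f n.
have und : {homo u : n m / (n <= m)%N >-> n <= m}.
  move=> n m nm; rewrite /u [leRHS](@big_cat_nat _ _ _ n.+1) //=.
  by rewrite lerDl sumr_ge0.
have ucv : cvgn u.
  apply: nondecreasing_is_cvgn => //; exists L => _ [n _ <-]; exact: fL.
have t2 : 0 < t / 2 by rewrite divr_gt0.
have /cvgrPdist_le/(_ _ t2)[M _ hM] := ucv.
exists M.+1; split => // M1; have [M1M|MM1] := leqP M1 M.+1.
  by rewrite big_geq // ltW.
case: M1 MM1 => // M1; rewrite ltnS => MM1.
have -> : \sum_(M.+1 <= n < M1.+1) f n = u M1 - u M.
  have MM : (M < M1.+1)%N by exact: leqW.
  by rewrite /u (@big_cat_nat _ _ _ M.+1 1 M1.+1) //= addrAC subrr add0r.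
have := hM M (leqnn _); have := hM M1 (ltnW MM1) => /= h1 h2.
have -> : u M1 - u M = (limn u - u M) - (limn u - u M1) by ring.
apply: le_trans (ler_norm _) _; apply: le_trans (ler_normB _ _) _.
by rewrite [leRHS](splitr t) lerD.
Qed.

Lemma layer_le_ln (R : realType) (n : nat) : (1 < n)%N ->
  (layer n)%:R <= 2 / ln 2 * ln (n%:R : R).
Proof.
move=> n1; have n0 : (0 < n)%N by exact: ltnW.
have ln20 : 0 < ln 2 :> R by rewrite ln_gt0 // ltr1n.
set p := trunc_log 2 n.
have p0 : (0 < p)%N by rewrite trunc_log_gt0 /=; case: n n1 {n0 p}.
have /= /andP[pn _] := trunc_log_bounds (ltnSn 1) n0.
have h : ln 2 * p%:R <= ln (n%:R : R).
  rewrite mulr_natr -lnXn // ler_ln ?posrE ?exprn_gt0 ?ltr0n //.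
  by rewrite -natrX ler_nat.
rewrite mulrAC ler_pdivlMr // /layer -/p.
apply: (@le_trans _ _ (2 * (ln 2 * p%:R))); last by rewrite ler_wpM2l.
have -> : 2 * (ln 2 * p%:R) = (2 * p%:R) * ln 2 :> R by ring.
apply: ler_wpM2r; first exact: ltW.
by rewrite -natrM ler_nat; lia.
Qed.

Lemma divisor_sum_pow_ge1 (R : realType) (s : R) (k : nat) : (0 < k)%N ->
  1 <= divisor_sum (pow_weight s) k.
Proof.
move=> k0; rewrite /divisor_sum (bigD1_seq 1%N) ?divisors_uniq //=; last first.
  by rewrite -dvdn_divisors // dvd1n.
rewrite /pow_weight powR1 lerDl; apply: sumr_ge0 => d _; exact: powR_ge0.
Qed.

(** The hypothesis does not control the term [n = 1], where [ln n] vanishes;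
    it is a single constant, and [layer n = O (ln n)] for the others. *)
Lemma weighted_energy_bounded (R : realType) (s : R) (k : nat -> nat)
    (c : nat -> R) :
  (forall n, (0 < n)%N -> (0 < k n)%N) ->
  (\sum_(1 <= n <oo) ((c n) ^+ 2 * sigma (1 - 2 * s) (k n) *
                        (ln n%:R) ^+ 2)%:E < +oo)%E ->
  exists L : R, forall N, \sum_(1 <= n < N)
    c n ^+ 2 * divisor_sum (pow_weight s) (k n) * (layer n)%:R ^+ 2 <= L.
Proof.
move=> k0 csum.
pose g n := c n ^+ 2 * divisor_sum (pow_weight s) (k n).
have g0 n : 0 <= g n.
  apply: mulr_ge0; first exact: sqr_ge0.
  by apply: sumr_ge0 => d _; exact: powR_ge0.
pose S := (\sum_(1 <= n <oo) (g n * (ln n%:R) ^+ 2)%:E)%E.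
have Sfin : S \is a fin_num.
  rewrite ge0_fin_numE //; apply: nneseries_ge0 => n _ _.
  by rewrite lee_fin mulr_ge0 // sqr_ge0.
have gS N : \sum_(1 <= n < N) g n * (ln n%:R) ^+ 2 <= fine S.
  rewrite -lee_fin fineK // -sumEFin; apply: nneseries_lim_ge => n _ _.
  by rewrite lee_fin mulr_ge0 // sqr_ge0.
have S0 : 0 <= fine S by have := gS 0%N; rewrite big_geq.
pose K := (2 / ln 2) ^+ 2 : R.
have K0 : 0 <= K by exact: sqr_ge0.
exists (g 1%N * (layer 1)%:R ^+ 2 + K * fine S) => N.
have base : 0 <= g 1%N * (layer 1)%:R ^+ 2 by rewrite mulr_ge0 ?sqr_ge0.
have [N1|N1] := leqP N 1.
  by rewrite big_geq // addr_ge0 // mulr_ge0.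
rewrite big_ltn // lerD2l; apply: le_trans (ler_wpM2l K0 (gS N)).
rewrite [in leRHS]big_ltn // mulrDr ln1 expr0n /= !mulr0 add0r mulr_sumr.
apply: ler_sum_nat => n /andP[n1 _]; rewrite -/(g n) [leRHS]mulrCA.
apply: ler_wpM2l => //; rewrite -exprMn ler_pXn2r ?nnegrE ?layer_le_ln //.
by rewrite mulr_ge0 ?divr_ge0 ?ln_ge0 ?ler1n // ltnW.
Qed.

(** Orthogonality controls [s_N - s_J] for the partial sums [s_N], and
    [f - s_N] tends to zero in square norm. *)
Lemma truncation_error_le (R : realType) (s A : R) (a : nat -> R) (f : R -> R)
    (P : nat) :
  1 / 2 < s -> 0 <= A ->
  (forall j, (0 < j)%N -> a j ^+ 2 <= A * (pow_weight s j / j%:R)) ->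
  is_sine_series a f ->
  (\int[lebesgue_measure]_(x in `[0%R, 1%R])
     ((f x - sine_psum a (2 ^ P).-1 x) ^+ 2)%:E <=
   (2 * A * (1 - pow_weight s 2)^-1 * pow_weight s 2 ^+ P)%:E)%E.
Proof.
move=> s2 A0 aA [mf fp fcv]; set J := (2 ^ P).-1.
set Z := (1 - _)^-1; set rho := pow_weight s 2.
have JP : J.+1 = (2 ^ P)%N by rewrite /J prednK // expn_gt0.
have mI : measurable (`[0, 1] : set R) by exact: measurable_itv.
have msp b N (D : set R) : measurable_fun D (sine_psum b N).
  by apply: measurable_funTS; apply: continuous_measurable_fun;
     exact: continuous_sine_psum.
have mfI (D : set R) : measurable_fun D f by exact: measurable_funTS.
have tail N : (J <= N)%N -> (\int[lebesgue_measure]_(x in `[0%R, 1%R])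
     ((sine_psum a N x - sine_psum a J x) ^+ 2)%:E <= (A * (rho ^+ P * Z))%:E)%E.
  move=> JN; pose b j := if (J < j)%N then a j else 0.
  have E x : sine_psum a N x - sine_psum a J x = sine_psum b N x.
    rewrite /sine_psum (@big_cat_nat _ _ _ J.+1) //= addrAC subrr add0r.
    rewrite [RHS](@big_cat_nat _ _ _ J.+1) //= big_nat_cond.
    rewrite [in RHS]big_nat_cond [X in _ = X + _]big1 ?add0r; last first.
      move=> j; rewrite andbT ltnS => /andP[_ jJ].
      by rewrite /b ltnNge jJ mul0r.
    rewrite [RHS]big_nat_cond; apply: eq_bigr => j; rewrite andbT.
    by move=> /andP[Jj _]; rewrite /b Jj.
  under eq_integral do rewrite E.
  apply: (@le_trans _ _ (\int[lebesgue_measure]_(x in sym_itv R 1)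
      ((sine_psum b N x) ^+ 2)%:E)%E).
    apply: ge0_subset_integral => //.
    - exact: measurable_sym_itv.
    - by apply/measurable_EFinP/measurable_funX; exact: msp.
    - by move=> x _; rewrite lee_fin sqr_ge0.
    - move=> x; rewrite /sym_itv /= !in_itv /= => /andP[x0 ->].
      by rewrite andbT; lra.
  rewrite integral_sine_psum_sqr // lee_fin mul1r.
  apply: le_trans (ler_wpM2l A0 (pow_weight_tail P N.+1 s2)).
  rewrite (@big_cat_nat _ _ _ J.+1) //= big_nat_cond big1 ?add0r; last first.
    move=> j; rewrite andbT ltnS => /andP[_ jJ].
    by rewrite /b ltnNge jJ expr0n.
  rewrite JP mulr_sumr; apply: ler_sum_nat => j /andP[Pj _].
  have Jj : (J < j)%N by rewrite JP.
  by rewrite /b Jj; apply: aA; exact: leq_ltn_trans Jj.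
apply/lee_addgt0Pr => e e0.
have e2 : (0 < (e / 2)%:E)%E by rewrite lte_fin divr_gt0.
have [N0 _ hN0] : \forall N \near \oo, (\int[lebesgue_measure]_(x in `[0%R, 1%R])
     ((f x - sine_psum a N x) ^+ 2)%:E < (e / 2)%:E)%E.
  apply: (fcv [set y | (y < (e / 2)%:E)%E]).
  by apply: open_nbhs_nbhs; split; first exact: open_ereal_lt_ereal.
pose N := maxn N0 J.
have hN := hN0 N (leq_maxl _ _); have JN : (J <= N)%N := leq_maxr _ _.
have mdiff b b' N' N'' (D : set R) : measurable_fun D
    (fun x => ((sine_psum b N' x - sine_psum b' N'' x) ^+ 2)%:E).
  by apply/measurable_EFinP/measurable_funX/measurable_funB; exact: msp.
have mfd N' (D : set R) : measurable_fun D
    (fun x => ((f x - sine_psum a N' x) ^+ 2)%:E).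
  by apply/measurable_EFinP/measurable_funX/measurable_funB;
     [exact: mfI|exact: msp].
apply: (@le_trans _ _ (\int[lebesgue_measure]_(x in `[0%R, 1%R])
   (2%:E * ((f x - sine_psum a N x) ^+ 2)%:E +
    2%:E * ((sine_psum a N x - sine_psum a J x) ^+ 2)%:E))%E).
  apply: ge0_le_integral => //.
  - by move=> x _; rewrite lee_fin sqr_ge0.
  - exact: mfd.
  - by apply: emeasurable_funD; apply: measurable_funeM; [exact: mfd|exact: mdiff].
  - move=> x _; rewrite -!EFinM -EFinD lee_fin -subr_ge0.
    set p := f x; set q := sine_psum a N x; set r := sine_psum a J x.
    have -> : 2 * (p - q) ^+ 2 + 2 * (q - r) ^+ 2 - (p - r) ^+ 2 =
      (p - 2 * q + r) ^+ 2 by ring.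
    exact: sqr_ge0.
rewrite ge0_integralD //; last 4 first.
- by move=> x _; rewrite mule_ge0 ?lee_fin ?sqr_ge0.
- apply: measurable_funeM; first [exact: mfd|exact: mdiff].
- by move=> x _; rewrite mule_ge0 ?lee_fin ?sqr_ge0.
- apply: measurable_funeM; first [exact: mfd|exact: mdiff].
rewrite (ge0_integralZl lebesgue_measure mI (mfd N _)) //; last first.
  by move=> x _; rewrite lee_fin sqr_ge0.
rewrite (ge0_integralZl lebesgue_measure mI (mdiff a a N J _)) //; last first.
  by move=> x _; rewrite lee_fin sqr_ge0.
apply: le_trans (leeD (lee_wpmul2l _ (ltW hN)) (lee_wpmul2l _ (tail N JN))) _.
- by rewrite lee_fin.
- by rewrite lee_fin.
rewrite -!EFinM -!EFinD lee_fin le_eqVlt; apply/orP; left; apply/eqP.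
by move: Z {tail} => Z; field.
Qed.

(** * Convergence *)

(** By [|c g| <= c^2 + g^2] the series of absolute values has a finite
    integral. *)
Lemma ae_cvgn_dilated_series (R : realType) (g : nat -> R -> R) (b c : nat -> R)
    (k : nat -> nat) (m : nat) (L : R) :
  (forall n, (0 < n)%N -> (0 < k n)%N) ->
  (forall n, measurable_fun [set: R] (g n)) ->
  (forall n x, g n (x + 1) = g n x) ->
  (forall n, (\int[lebesgue_measure]_(x in `[0%R, 1%R]) ((g n x) ^+ 2)%:E
                <= (b n)%:E)%E) ->
  (forall N, \sum_(1 <= n < N) (c n ^+ 2 + b n) <= L) ->
  {ae lebesgue_measure, forall x : R, sym_itv R m x ->
     cvgn (fun M => \sum_(1 <= n < M.+1) c n * g n ((k n)%:R * x))}.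
Proof.
move=> k0 mg gp gb bL; set D := sym_itv R m.
have mD : measurable D by exact: measurable_sym_itv.
pose h (i : nat) (x : R) : \bar R := (`|c i.+1 * g i.+1 ((k i.+1)%:R * x)|)%:E.
have mh i : measurable_fun D (h i).
  apply/measurable_EFinP/measurableT_comp => //; apply: measurable_funTS.
  apply: measurable_funM; first exact: measurable_cst.
  exact: measurableT_comp (mulrl_measurable _).
have h0 i x : D x -> (0 <= h i x)%E by rewrite lee_fin.
have m2 : 0 <= 2 * m%:R :> R by rewrite mulr_ge0.
have hI i : (\int[lebesgue_measure]_(x in D) h i x <=
    (2 * m%:R * (c i.+1 ^+ 2 + b i.+1))%:E)%E.
  pose G y := c i.+1 ^+ 2 + g i.+1 y ^+ 2.
  have mG : measurable_fun [set: R] G.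
    by apply: measurable_funD; [exact: measurable_cst|exact: measurable_funX].
  have G0 y : 0 <= G y by rewrite addr_ge0 ?sqr_ge0.
  have Gp y : G (y + 1) = G y by rewrite /G gp.
  apply: (@le_trans _ _
      (\int[lebesgue_measure]_(x in D) (G ((k i.+1)%:R * x))%:E)%E).
    apply: ge0_le_integral => //.
    - exact: h0.
    - exact: mh.
    - apply/measurable_EFinP/measurable_funTS.
      exact: (measurableT_comp mG (mulrl_measurable _)).
    - move=> x _; rewrite lee_fin /G; set p := c _; set q := g _ _.
      rewrite normrM -[p ^+ 2]real_normK ?num_real //.
      rewrite -[q ^+ 2]real_normK ?num_real //.
      have := sqr_ge0 (`|p| - `|q|); have := normr_ge0 p; have := normr_ge0 q.
      nra.
  rewrite integral_dilated_periodic ?k0 // [leRHS]EFinM.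
  apply: lee_wpmul2l; first by rewrite lee_fin.
  have mI : measurable (`[0, 1] : set R) by exact: measurable_itv.
  under eq_integral do rewrite /G EFinD.
  rewrite ge0_integralD //; last 3 first.
  - by move=> x _; rewrite lee_fin sqr_ge0.
  - by move=> x _; rewrite lee_fin sqr_ge0.
  - by apply/measurable_EFinP/measurable_funX/measurable_funTS; exact: mg.
  have unit : lebesgue_measure (`[0, 1]%classic : set R) = 1%E.
    by rewrite (lebesgue_measure_itv `[0, 1]) /= lte_fin ltr01 oppr0 adde0.
  rewrite EFinD leeD ?gb // integral_cst // -[leRHS]mule1.
  by apply: lee_wpmul2l; [rewrite lee_fin sqr_ge0|rewrite -unit].
have SI : (\int[lebesgue_measure]_(x in D) \sum_(0 <= i <oo) h i x <=
    (2 * m%:R * L)%:E)%E.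
  rewrite integral_nneseries //; apply: lime_le.
    by apply: is_cvg_nneseries => n _ _; apply: integral_ge0 => x; exact: h0.
  apply: nearW => N; apply: le_trans (lee_sum _ (fun i _ => hI i)) _.
  rewrite sumEFin lee_fin -mulr_sumr ler_wpM2l //.
  by have := bL N.+1; rewrite big_add1.
have Sint : lebesgue_measure.-integrable D (fun x => \sum_(0 <= i <oo) h i x)%E.
  apply/integrableP; split.
    by apply: ge0_emeasurable_sum => [n x Dx _|n _]; [exact: h0|exact: mh].
  apply: le_lt_trans (le_trans _ SI) (ltry _).
  rewrite le_eqVlt; apply/orP; left; apply/eqP.
  apply: eq_integral => x /set_mem Dx; rewrite gee0_abs //.
  by apply: nneseries_ge0 => n _ _; exact: h0.
move/integrable_ae : Sint => /(_ mD); apply: filterS => x Sx Dx.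
have {}Sx := Sx Dx.
pose u i := c i.+1 * g i.+1 ((k i.+1)%:R * x).
have -> : (fun M => \sum_(1 <= n < M.+1) c n * g n ((k n)%:R * x)) = series u.
  by apply/funext => M; rewrite /series /= big_add1.
apply: normed_cvg; apply: nondecreasing_is_cvgn.
  move=> p q pq; rewrite /series /= [leRHS](@big_cat_nat _ _ _ p) //=.
  by rewrite lerDl sumr_ge0.
exists (fine (\sum_(0 <= i <oo) h i x)%E) => _ [N _ <-].
rewrite /series /= -lee_fin fineK // -sumEFin.
by apply: nneseries_lim_ge => n _ _; exact: h0.
Qed.

(** The maximal inequality is applied to the coefficients of index at least
    [M0], for which the energy is as small as desired. *)
Lemma ae_cvgn_truncated_series (R : realType) (w : nat -> R) (Z A L : R)
    (k : nat -> nat) (a c : nat -> R) (C m : nat) :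
  mult_weight w Z -> (forall n, (0 < n)%N -> (0 < k n)%N) ->
  (forall n, (0 < n)%N -> (k n < k n.+1)%N) ->
  0 <= A -> (forall j, (0 < j)%N -> a j ^+ 2 <= A * (w j / j%:R)) ->
  (0 < m)%N ->
  (forall N, \sum_(1 <= n < N)
     c n ^+ 2 * divisor_sum w (k n) * (layer n)%:R ^+ 2 <= L) ->
  {ae lebesgue_measure, forall x : R, sym_itv R m x ->
     cvgn (fun M => \sum_(1 <= n < M.+1)
             c n * sine_psum a (cut C n).-1 ((k n)%:R * x))}.
Proof.
move=> hw k0 kS A0 aA m0 cL.
have [K [K0 HK]] := dilated_maximal_inequality C hw k0 kS A0 aA m0.
pose e n := c n ^+ 2 * divisor_sum w (k n) * (layer n)%:R ^+ 2.
have e0 n : 0 <= e n.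
  apply: mulr_ge0; last exact: sqr_ge0.
  by apply: mulr_ge0; [exact: sqr_ge0|exact: divisor_sum_ge0 hw].
apply: ae_cvgn_of_maximal_bound.
  move=> M; apply: continuous_bigsum => n; apply: continuous_mull.
  have : continuous (sine_psum a (cut C n).-1 \o (fun y => (k n)%:R * y)).
    move=> x; apply: continuous_comp; first exact: mulrl_continuous.
    exact: continuous_sine_psum.
  exact.
move=> eps d eps0 d0.
pose l := eps / 3; have l0 : 0 < l by rewrite divr_gt0.
pose K' := 3 * (K + 1).
have K'0 : 0 < K' by apply: mulr_gt0 => //; exact: ltr_wpDl.
(* First [t] is chosen against [l], then the energy against both, so that each
   of the three terms of the maximal inequality is at most [d / 3]. *)
pose t := d * l / K'; have t0 : 0 < t by apply: divr_gt0 => //; exact: mulr_gt0.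
pose r := Num.min (d * (t * l) / K') (d * l ^+ 2 / K').
have r0 : 0 < r.
  have tl0 : 0 < t * l by exact: mulr_gt0.
  have ll0 : 0 < l ^+ 2 by exact: exprn_gt0.
  by rewrite lt_min; apply/andP; split; apply: divr_gt0 => //; exact: mulr_gt0.
have [M0 [M00 hM0]] := bounded_sum_tail e0 cL r0.
exists M0.-1 => M1; pose T := M1.+2.
have M1T : (M1.+1 < 2 ^ T)%N by rewrite (ltn_trans (ltnSn _)) // ltn_expl.
pose c' := seg_coef M0 M1.+1 c.
have cT n : ~~ (0 < n < 2 ^ T)%N -> c' n = 0.
  rewrite /c' /seg_coef; case: ifP => // /andP[M0n nM1].
  by rewrite (leq_trans M00 M0n) (leq_trans nM1 (ltnW M1T)).
have Er : energy w k c' T <= r.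
  apply: le_trans (hM0 M1.+1).
  have -> : energy w k c' T =
      \sum_(1 <= n < 2 ^ T) seg_coef M0 M1.+1 (fun n => c n ^+ 2) n *
         (divisor_sum w (k n) * (layer n)%:R ^+ 2).
    apply: eq_bigr => n _; rewrite /c' /seg_coef; case: ifP => _.
      by rewrite [RHS]mulrA.
    by rewrite expr0n /= !mul0r.
  have -> : \sum_(1 <= n < 2 ^ T) seg_coef M0 M1.+1 (fun n => c n ^+ 2) n *
         (divisor_sum w (k n) * (layer n)%:R ^+ 2) =
     \sum_(1 <= n < 2 ^ T) seg_coef M0 M1.+1 e n * 1.
    apply: eq_bigr => n _; rewrite /seg_coef /e; case: ifP => _.
      by rewrite mulr1 [LHS]mulrA.
    by rewrite !mul0r.
  rewrite (@sum_nat_segE _ _ 1 (2 ^ T) (2 ^ T)) //.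
  rewrite (@sum_nat_segE _ _ M0 M1.+1 (2 ^ T)) ?(ltnW M1T) //.
  rewrite big_mkcond [leRHS]big_mkcond; apply: ler_sum => n _.
  rewrite /seg_coef.
  by case: ifP => // _; case: ifP => // _; rewrite ?mulr1 ?mul0r ?e0.
have [B [mB hB BP]] := HK T c' l t cT l0 t0.
exists B; split => //.
  apply: le_trans hB _; rewrite lee_fin.
  set E := energy w k c' T in Er *.
  have hK : K * (K')^-1 <= 3^-1.
    rewrite ler_pdivrMr // /K' mulrA mulVf ?pnatr_eq0 // mul1r.
    by rewrite lerDl.
  have Er1 : E <= d * (t * l) / K' by apply: le_trans Er _; rewrite ge_min lexx.
  have Er2 : E <= d * l ^+ 2 / K'.
    by apply: le_trans Er _; rewrite ge_min lexx orbT.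
  have h1 : t / l = d / K' by rewrite /t; field; rewrite !gt_eqF.
  have tl0 : 0 < t * l by rewrite mulr_gt0.
  have h2 : E / (t * l) <= d / K'.
    by rewrite ler_pdivrMr // mulrAC.
  have h3 : E / l ^+ 2 <= d / K'.
    by rewrite ler_pdivrMr ?exprn_gt0 // mulrAC.
  apply: (@le_trans _ _ (K * (d / K' + d / K' + d / K'))).
    by apply: ler_wpM2l => //; rewrite h1 !lerD.
  have -> : K * (d / K' + d / K' + d / K') = 3 * d * (K * K'^-1) by ring.
  have -> : d = 3 * d * 3^-1 by field.
  rewrite [X in 3 * X * _](_ : _ = d); last by field.
  by apply: ler_wpM2l => //; rewrite mulr_ge0 // ltW.
move=> x M xm Bx /andP[M0M MM1].
have MT : (M.+1 < 2 ^ T)%N by apply: leq_ltn_trans M1T; rewrite ltnS.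
have := BP x M xm Bx MT; rewrite (_ : 3 * l = eps); last by rewrite /l; field.
rewrite (@big_cat_nat _ _ _ M0 1 M.+1) //=; last first.
  by rewrite -(prednK M00) ltnS.
rewrite big_nat_cond big1 ?add0r; last first.
  move=> n; rewrite andbT => /andP[_ nM0].
  by rewrite /c' /seg_coef leqNgt nM0 mul0r.
rewrite prednK //.
have -> : \sum_(1 <= n < M.+1) c n * sine_psum a (cut C n).-1 ((k n)%:R * x) -
    \sum_(1 <= n < M0) c n * sine_psum a (cut C n).-1 ((k n)%:R * x) =
   \sum_(M0 <= n < M.+1) c n * sine_psum a (cut C n).-1 ((k n)%:R * x).
  rewrite (@big_cat_nat _ _ _ M0 1 M.+1) //=; last first.
    by rewrite -(prednK M00) ltnS.
  by rewrite addrAC subrr add0r.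
rewrite (eq_big_nat _ _ (F2 := fun n =>
  c n * sine_psum a (cut C n).-1 ((k n)%:R * x))) // => n /andP[M0n nM].
by rewrite /c' /seg_coef M0n (leq_trans nM).
Qed.

Theorem theorem2p8 (R : realType) (k : nat -> nat) (s : R)
    (a : nat -> R) (f : R -> R) (c : nat -> R)
    (k1_ge1 : (1 <= k 1)%N)
    (k_incr : forall n, (1 <= n)%N -> (k n < k n.+1)%N)
    (fE : is_sine_series a f)
    (s_gt : 1 / 2 < s)
    (a_bigO : a =O_\oo (fun j : nat => j%:R `^ (- s)))
    (c_sum : (\sum_(1 <= n <oo)
                ((c n) ^+ 2 * sigma (1 - 2 * s) (k n) * (ln n%:R) ^+ 2)%:E
              < +oo)%E) :
  {ae lebesgue_measure, forall x : R,
    cvgn (fun N => \sum_(1 <= n < N.+1) c n * dilate f (k n) x)}.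
Proof.
have k0 n : (0 < n)%N -> (0 < k n)%N.
  case: n => // n _; elim: n => // n IH; exact: leq_ltn_trans (k_incr _ _).
have [A [A0 aA]] := bigO_coef_sqr_le a_bigO.
have hw := pow_weight_mult_weight s_gt.
set rho := pow_weight s 2 in hw; set Z := (1 - rho)^-1 in hw.
have Z0 : 0 <= Z := mult_weight_bound_ge0 hw.
have rho0 : 0 <= rho by exact: powR_ge0.
(* The quotient 1/4 yields [4^-(layer n) <= n^-2] for the truncation error. *)
have [C hC] := exp_le_quarter rho0 (pow_weight2_lt1 s_gt).
have [L hL] := weighted_energy_bounded k0 c_sum.
have [mf fp _] := fE.
pose g n x := f x - sine_psum a (cut C n).-1 x.
pose b n := 2 * A * Z * ((n%:R : R) ^+ 2)^-1.
have mg n : measurable_fun [set: R] (g n).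
  apply: measurable_funB => //; apply: continuous_measurable_fun.
  exact: continuous_sine_psum.
have gp n x : g n (x + 1) = g n x.
  rewrite /g fp; congr (_ - _); apply: eq_bigr => j _; congr (_ * _).
  rewrite mulrDr mulr1.
  have -> : 2 * pi * j%:R = (pi *+ 2) *+ j :> R by rewrite mulr_natl mulr_natr.
  by rewrite (periodicn (sinD2pi (R := R))).
have gb n : (0 < n)%N -> (\int[lebesgue_measure]_(x in `[0%R, 1%R])
    ((g n x) ^+ 2)%:E <= (b n)%:E)%E.
  move=> n0; apply: le_trans (truncation_error_le (C * layer n) s_gt A0 aA fE) _.
  rewrite lee_fin /b ler_wpM2l ?mulr_ge0 // -/rho.
  have /= /andP[_ nl] := trunc_log_bounds (ltnSn 1) n0; rewrite -/(layer n) in nl.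
  rewrite exprM; apply: (@le_trans _ _ (4^-1 ^+ layer n)).
    by rewrite ler_pXn2r ?nnegrE ?exprn_ge0.
  rewrite exprVn lef_pV2 ?posrE ?exprn_gt0 ?ltr0n //.
  rewrite (_ : 4 = 2 ^+ 2); last by ring.
  rewrite exprAC ler_pXn2r ?nnegrE ?exprn_ge0 //.
  by rewrite -natrX ler_nat ltnW.
(* Index 0 does not occur in the series, but the bound on [g 0] could fail. *)
pose g' n := if n is 0 then (fun=> 0) else g n.
have main (m : nat) : {ae lebesgue_measure, forall x : R, sym_itv R m.+1 x ->
    cvgn (fun N => \sum_(1 <= n < N.+1) c n * dilate f (k n) x)}.
  have ae1 := ae_cvgn_truncated_series C hw k0 k_incr A0 aA (ltn0Sn m) hL.
  have ae2 : {ae lebesgue_measure, forall x : R, sym_itv R m.+1 x ->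
     cvgn (fun M => \sum_(1 <= n < M.+1) c n * g' n ((k n)%:R * x))}.
    apply: (@ae_cvgn_dilated_series R g' b c k m.+1 (L + 4 * A * Z)) => //.
    - by case=> [|n]; [exact: measurable_cst|exact: mg].
    - by case=> [|n] x //=; exact: gp.
    - case=> [|n]; last exact: gb.
      rewrite integral0_eq; last by move=> x _; rewrite /= expr0n.
      by rewrite lee_fin /b !mulr_ge0 // invr_ge0 sqr_ge0.
    move=> N; rewrite big_split /= lerD //.
      apply: le_trans (hL N); apply: ler_sum_nat => n /andP[n0 _].
      rewrite -mulrA ler_peMr ?sqr_ge0 //.
      rewrite -[leLHS]mul1r ler_pM //.
        exact: divisor_sum_pow_ge1 (k0 _ n0).
      by rewrite expr_ge1 // ler1n.
    rewrite /b -mulr_sumr (_ : 4 * A * Z = 2 * A * Z * 2); last by ring.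
    rewrite ler_wpM2l ?mulr_ge0 //; case: N => [|N]; first by rewrite big_geq.
    by rewrite big_add1 /= sum_squares_inv_le.
  have FF := ae_filter_ringOfSetsType (@lebesgue_measure R).
  apply: (filterS2 _ _ ae1 ae2) => x h1 h2 xm.
  have -> : (fun N => \sum_(1 <= n < N.+1) c n * dilate f (k n) x) =
    (fun M => \sum_(1 <= n < M.+1)
             c n * sine_psum a (cut C n).-1 ((k n)%:R * x)) \+
    (fun M => \sum_(1 <= n < M.+1) c n * g' n ((k n)%:R * x)).
    apply/funext => M /=; rewrite -big_split /=.
    apply: eq_big_nat => -[//|n] _ /=.
    by rewrite /g /dilate -mulrDr addrC subrK.
  by apply: is_cvgD; [exact: h1|exact: h2].
have := ae_foralln main; apply: filterS => x /(_ (Num.truncn `|x|)); apply.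
have := truncnS_gt `|x|; rewrite /sym_itv /= in_itv /= ltr_norml.
by move=> /andP[/ltW -> /ltW ->].
Qed.
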